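(* There exist an algorithm for online convex optimization and an absolute constant $C$ such that, for all sufficiently large $d$, given a convex body $\mathcal K\subseteq\{x\in\mathbb R^d:\|x\|_1\le1\}$ and any sequence of online loss functions $f^{(1)},\dots,f^{(T)}$ with bounded gradients, the algorithm achieves regret satisfying $$\frac{\mathbb E[\mathrm{regret}(T)]}{\sqrt T}\ \le\ C\sqrt{\ln\ln d}\cdot\min_{n\in[d]}D_nG_n,$$ as long as $T\ge4\ln\ln d$, where $D_n$ is the root-mean-square diameter of $\mathcal K$ for the $n$-th random block norm and $G_n=\max_{t\in[T]}\big(\mathbb E_{\mathcal B}[\sup_{x\in\mathcal K}(\|\nabla f^{(t)}(x)\|^{*}_{[\mathcal B]})^{2}]\big)^{1/2}$ is the gradient bound for the $n$-th random block norm ($\mathcal B$ a uniformly random equal-size $n$-partition of $[d]$).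
   Context: Online convex optimization: $\mathcal K$ (closed, bounded, convex, not $\{0\}$) has a fixed starting point $x^{(1)}\in\mathcal K$; in round $t=1,\dots,T$ the algorithm plays $x^{(t)}\in\mathcal K$ based on $f^{(1)},\dots,f^{(t-1)}$ and its internal randomness, then the convex differentiable loss $f^{(t)}$ is revealed. The loss sequence is fixed in advance (oblivious adversary). $\mathrm{regret}(T)=\sum_tf^{(t)}(x^{(t)})-\min_{x\in\mathcal K}\sum_tf^{(t)}(x)$; the expectation is over the algorithm's random partitions. The algorithm does not know the sparsity of the gradients or the optimal $n$; it is given $T$, the Euclidean diameter $\max_{x,z\in\mathcal K}\|x-z\|_2$, the Euclidean gradient bound $\max_{t}\sup_{x\in\mathcal K}\|\nabla f^{(t)}(x)\|_2$, and the value-range bound $\rho=\max_{t}\sup_{x,z\in\mathcal K}(f^{(t)}(x)-f^{(t)}(z))$. Block norms. $[d]=\{1,\dots,d\}$. For a partition $\mathcal B=\{B_1,\dots,B_n\}$ of $[d]$ into nonempty blocks, $\|x\|_{[\mathcal B]}=\sum_{j}\|x_{B_j}\|_2$ ($x_{B_j}$ is the restriction of $x$ to $B_j$), with dual norm $\|g\|^*_{[\mathcal B]}=\max_j\|g_{B_j}\|_2$. It is equal-size if block sizes differ by at most $1$. Put $(\gamma_1,p_1)=(1,2)$, $(\gamma_2,p_2)=(\tfrac12,2)$, and $\gamma_n=\frac1{e\ln n}$, $p_n=1+\frac1{\ln n}$ for $n\ge3$; $h_{\mathcal B}(x)=\frac1{\gamma_np_n}\sum_j\|x_{B_j}\|_2^{p_n}$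 and $h_{\mathcal B,\rho'}(x)=\rho'^2h_{\mathcal B}(x/\rho')$ for $\rho'>0$. $B_h(x\|y)=h(x)-h(y)-\langle\nabla h(y),x-y\rangle$. Let $\rho_n(\mathcal K)=\max_{\mathcal B}\sup_{x\in\mathcal K}\|x\|_{[\mathcal B]}$ over equal-size $n$-partitions, and $D_n=\big(\mathbb E_{\mathcal B}[\max_{z\in\mathcal K}B_{h_{\mathcal B,\rho_n(\mathcal K)}}(z\|x^{(1)})]\big)^{1/2}$ with $\mathcal B$ a uniformly random equal-size $n$-partition. *)

(* Defs.v *)
(* Vectors of R^d are row vectors of type 'rV[R]_d. *)
From mathcomp Require Export all_boot all_order all_algebra.
From mathcomp Require Export all_classical all_reals all_analysis.

Set Implicit Arguments.
Unset Strict Implicit.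
Unset Printing Implicit Defensive.

Export Order.TTheory GRing.Theory Num.Theory.
Export numFieldNormedType.Exports.

Local Open Scope classical_set_scope.
Local Open Scope ring_scope.

Section Vectors.
Context {R : realType} {d : nat}.
Implicit Types (x y u v : 'rV[R]_d) (f h : 'rV[R]_d -> R).

Definition dotp u v : R := \sum_i u 0 i * v 0 i.

(* The library norm `|x| on 'rV[R]_d is the sup norm, hence l1norm and l2norm. *)
Definition l1norm x : R := \sum_i `|x 0 i|.
Definition l2norm x : R := Num.sqrt (\sum_i x 0 i ^+ 2).

Definition grad f x : 'rV[R]_d :=
  \row_i 'D_(delta_mx 0 i) (f : 'rV[R]_d -> R^o) x.

Definition bregman h x y : R := h x - h y - dotp (grad h y) (x - y).

End Vectors.

Section BlockNorms.
Context {R : realType} {d : nat}.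
Implicit Types (A : {set 'I_d}) (P : {set {set 'I_d}}) (x : 'rV[R]_d).
Implicit Types (K : set 'rV[R]_d) (n : nat).

(* Unordered partitions of [set: 'I_d]; blocks are nonempty by [partition]. *)
Definition equal_partitions n : {set {set {set 'I_d}}} :=
  [set P : {set {set 'I_d}} | [&& finset.partition P [set: 'I_d], #|P| == n
             & [forall A in P, forall B in P, (#|A| <= #|B|.+1)%N]]]%SET.

Definition mean_partition n (F : {set {set 'I_d}} -> R) : R :=
  (\sum_(P in equal_partitions n) F P) / #|equal_partitions n|%:R.

Definition block_l2 A x : R := Num.sqrt (\sum_(i in A) x 0 i ^+ 2).

Definition block_norm P x : R := \sum_(A in P) block_l2 A x.

Definition block_dual_norm P x : R := \big[Num.max/0]_(A in P) block_l2 A x.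

Definition block_gamma n : R :=
  if n == 1%N then 1 else if n == 2%N then 2^-1
  else (expR 1 * ln n%:R)^-1.

Definition block_exponent n : R :=
  if (n <= 2)%N then 2 else 1 + (ln n%:R)^-1.

Definition block_dgf P x : R :=
  (block_gamma #|P| * block_exponent #|P|)^-1 *
  \sum_(A in P) block_l2 A x `^ block_exponent #|P|.

Definition block_dgf_scaled P (rho : R) x : R :=
  rho ^+ 2 * block_dgf P (rho^-1 *: x).

(* In the suprema below all sets are nonempty and bounded when K is nonempty
   and compact, except that [sup_dual_grad_sq] also needs the gradients of f to
   be bounded on K; the default value of [sup] then never intervenes. *)

Definition block_radius n K : R :=
  \big[Num.max/0]_(P in equal_partitions n) sup [set block_norm P x | x in K].

Definition block_diameter n K (x1 : 'rV[R]_d) : R :=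
  Num.sqrt (mean_partition n (fun P =>
    sup [set bregman (block_dgf_scaled P (block_radius n K)) z x1 | z in K])).

Definition sup_dual_grad_sq P K (f : 'rV[R]_d -> R) : R :=
  sup [set block_dual_norm P (grad f x) ^+ 2 | x in K].

Definition block_grad_bound n K (T : nat) (f : T.-tuple ('rV[R]_d -> R)) : R :=
  \big[Num.max/0]_(t < T)
    Num.sqrt (mean_partition n (fun P => sup_dual_grad_sq P K (tnth f t))).

End BlockNorms.

Section OnlineConvexOptimization.
Context {R : realType}.

(* What a learner knows before the first round. *)
Record oco_input (d : nat) := OcoInput {
  body : set 'rV[R]_d;
  start : 'rV[R]_d;
  horizon : nat;
  l2_diameter : R;
  l2_grad_bound : R;
  value_range : R }.

(* Internal randomness is a finite probability space (coins, law), drawn before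
   the first round; [play w h] is the point played with coins w after the
   losses h (in order of revelation). *)
Record learner (d : nat) (I : oco_input d) := Learner {
  coins : finType;
  law : coins -> R;
  law_ge0 : forall w, 0 <= law w;
  law_sum1 : \sum_w law w = 1;
  play : coins -> seq ('rV[R]_d -> R) -> 'rV[R]_d;
  play_start : forall w, play w [::] = start I;
  play_body : body I (start I) -> forall w h, body I (play w h) }.

Definition oco_algorithm := forall (d : nat) (I : oco_input d), learner I.

Definition input_of (d : nat) (K : set 'rV[R]_d) (x1 : 'rV[R]_d)
    (T : nat) (f : T.-tuple ('rV[R]_d -> R)) : oco_input d :=
  {| body := K;
     start := x1;
     horizon := T;
     l2_diameter := sup [set l2norm (x - z) | x in K & z in K];
     l2_grad_bound := \big[Num.max/0]_(t < T)
       sup [set l2norm (grad (tnth f t) x) | x in K];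
     value_range := \big[Num.max/0]_(t < T)
       sup [set tnth f t x - tnth f t z | x in K & z in K] |}.

Definition iterate (d : nat) (I : oco_input d) (L : learner I) (T : nat)
    (f : T.-tuple ('rV[R]_d -> R)) (w : coins L) (t : 'I_T) : 'rV[R]_d :=
  play w (take t f).

Definition regret (d : nat) (I : oco_input d) (L : learner I) (T : nat)
    (f : T.-tuple ('rV[R]_d -> R)) (w : coins L) : R :=
  \sum_(t < T) tnth f t (iterate f w t) -
  inf [set \sum_(t < T) tnth f t x | x in body I].

Definition expected_regret (d : nat) (I : oco_input d) (L : learner I)
    (T : nat) (f : T.-tuple ('rV[R]_d -> R)) : R :=
  \sum_(w : coins L) law w * regret f w.

(* f need only be convex on K, and differentiable (as a function on R^d) at the
   points of K. *)
Definition admissible_loss (d : nat) (K : set 'rV[R]_d) (f : 'rV[R]_d -> R) :=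
  [/\ convex_function K (f : 'rV[R]_d -> R^o),
      forall x, K x -> differentiable (f : 'rV[R]_d -> R^o) x
    & has_ubound [set l2norm (grad f x) | x in K]].

End OnlineConvexOptimization.

Arguments oco_algorithm R : clear implicits.

(* Main.v *)
From mathcomp Require Import fingroup perm.
Require Import Defs.
From mathcomp Require Import ring lra zify.

Set Implicit Arguments.
Unset Strict Implicit.
Unset Printing Implicit Defensive.

(** The learner is a portfolio of experts combined by Hedge. Every expert is
    follow-the-regularized-leader, regularized by the Bregman divergence, from
    the starting point, of the mirror map of one random block norm, with one
    fixed step size; convexity of the losses lets the master play the weighted
    average of the experts instead of sampling one of them.

    A single expert. The exponent $p_n$ and the scaling $gamma_n$ are such that
    the factor $n^{p_n - 1}$ lost between the $l_1$ and $l_{p_n}$ norms of $n$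
    block norms is compensated, so the mirror map is strongly convex for the
    block norm, with a universal constant, on the ball of radius $rho_n(K)$.
    This is proved for midpoints only ([block_dgf_midpoint]), from the uniform
    convexity of powers of a Euclidean norm ([powR_norm_midpoint]). Midpoints
    are enough for a minimizer to enjoy quadratic growth
    ([ftrl_quadratic_growth]), and hence for the pathwise regret bound
    $Phi(u) / eta + 8 eta sum_t G_t^2$ ([ftrl_regret]); its mean over the
    partitions is $D_n^2 / eta + 8 eta T G_n^2$, that is of order
    $D_n G_n sqrt T$ for the best step size $eta$.

    Few experts suffice. The diameters $D_n$ are known to the learner, the
    gradient bounds $G_n$ are not. By transitivity of the permutations of
    $[d]$ on equal partitions, a uniform equal partition is a uniformly
    shuffled partition into intervals ([mean_partitionE]); for $n$ and $m$
    within a factor 2 an interval of one partition meets at most three of the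
    other, so $G_n$ and $G_m$ are comparable ([block_grad_bound_refine_le]).
    It is therefore enough to keep, in every dyadic range, the number of
    blocks with the least diameter. As for the step size, $G_n$ lies between
    $G / sqrt n$ and $G$, where $G$ is the given Euclidean gradient bound, so
    one of $O(ln d)$ step sizes in geometric progression is within a factor 2
    of the best one.

    The price of Hedge. With $N = O(ln^2 d)$ experts and losses of range
    $rho$, Hedge adds $2 rho sqrt (T ln N)$ ([hedge_regret]), where $ln N$ is at
    most $4 ln ln d$. Finally $rho$ is at most $12 D_n G_n$ for every $n$
    ([loss_range_le]): each partition bounds the range of a loss by the
    product of its own gradient bound and its own diameter, and the
    Cauchy-Schwarz inequality passes to the mean over the partitions. *)

(** * Equal partitions up to permutation *)

Section EqualPartitions.
Context {d : nat}.
Implicit Types (A B : {set 'I_d}) (P Q : {set {set 'I_d}}) (n : nat).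
Implicit Types (s : {perm 'I_d}).

Definition permute_blocks s P : {set {set 'I_d}} :=
  ((fun A : {set 'I_d} => s @: A) @: P)%SET.

Lemma permute_blocksM s t P :
  permute_blocks (s * t)%g P = permute_blocks t (permute_blocks s P).
Proof.
rewrite /permute_blocks -imset_comp; apply: eq_imset => A /=.
by rewrite -imset_comp; apply: eq_imset => i /=; rewrite permM.
Qed.

Lemma permute_blocks1 P : permute_blocks 1%g P = P.
Proof.
rewrite /permute_blocks -[RHS]imset_id; apply: eq_imset => A.
by rewrite -[RHS]imset_id; apply: eq_imset => i; rewrite perm1.
Qed.

Lemma equal_partitionsP n P : reflect
  [/\ finset.partition P [set: 'I_d]%SET, #|P| = n &
      forall A B, A \in P -> B \in P -> (#|A| <= #|B|.+1)%N]
  (P \in equal_partitions n).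
Proof.
rewrite inE; apply: (iffP and3P) => [[Pp /eqP Pn /forall_inP PAB]|[Pp Pn PAB]].
  by split=> // A B AP BP; have /forall_inP := PAB A AP; exact.
split => //; first exact/eqP.
by apply/forall_inP => A AP; apply/forall_inP => B BP; exact: PAB.
Qed.

Lemma permute_blocks_equal n s P :
  P \in equal_partitions n -> permute_blocks s P \in equal_partitions n.
Proof.
move=> /equal_partitionsP[Pp Pn PAB]; apply/equal_partitionsP; split.
- have -> : [set: 'I_d]%SET = (s @: [set: 'I_d])%SET.
    apply/setP => i; rewrite !finset.in_setT; apply/esym/imsetP.
    by exists (s^-1 i)%g; rewrite ?finset.in_setT ?permKV.
  by rewrite imset_partition//; exact: perm_inj.
- by rewrite card_imset//; exact/imset_inj/perm_inj.
- move=> _ _ /imsetP[A AP ->] /imsetP[B BP ->].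
  by rewrite !(card_imset _ (@perm_inj _ s)); exact: PAB.
Qed.

(** Only $n$ and $d$ enter: two equal partitions into $n$ blocks have the same
    multiset of block sizes, which is why a permutation maps one to the other. *)
Definition equal_shape n : seq nat :=
  nseq (n - d %% n) (d %/ n) ++ nseq (d %% n) (d %/ n).+1.

(** The least block size $m$ satisfies $n m <= d < n (m + 1)$. *)
Lemma equal_partition_card n P A : (0 < n)%N -> P \in equal_partitions n ->
  A \in P -> (#|A| == d %/ n) || (#|A| == (d %/ n).+1).
Proof.
move=> n0 /equal_partitionsP[Pp Pn PAB] AP.
have dE : d = \sum_(B in P) #|B| by rewrite -(card_partition Pp) cardsT card_ord.
have [B BP Bmin] := @arg_minnP _ A (mem P) (fun B => #|B|) AP.
have lo : n * #|B| <= d.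
  by rewrite [leqRHS]dE -Pn -sum_nat_const; apply: leq_sum => C CP; exact: Bmin.
have hi : d < n * #|B|.+1.
  rewrite [ltnLHS]dE -Pn -sum_nat_const (bigD1 B)//= [X in _ < X](bigD1 B)//= addSn ltnS.
  by rewrite leq_add2l; apply: leq_sum => C /andP[CP _]; exact: PAB.
have -> : d %/ n = #|B|.
  by apply/eqP; rewrite eqn_leq leq_divRL// [_ * n]mulnC lo andbT -ltnS ltn_divLR// mulnC.
have := Bmin A AP; have := PAB A B AP BP.
by rewrite leq_eqVlt ltnS => /orP[/eqP ->|AB BA]; rewrite ?eqxx ?orbT// eqn_leq AB BA.
Qed.

(** Listing the small blocks before the large ones makes the shape of the
    enumeration independent of the partition. *)
Lemma equal_partition_enum n P : (0 < n)%N -> P \in equal_partitions n ->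
  exists ss : seq (seq 'I_d), [/\ shape ss = equal_shape n,
    perm_eq (flatten ss) (enum 'I_d) &
    forall A, (A \in P) = (A \in [seq [set x in b]%SET | b <- ss])].
Proof.
move=> n0 Pn.
have PA A : A \in P -> (#|A| == d %/ n) || (#|A| == (d %/ n).+1).
  exact: equal_partition_card.
have /equal_partitionsP[Pp cP _] := Pn.
pose small A := #|A| == d %/ n.
pose lo := [seq A <- enum P | small A]; pose hi := [seq A <- enum P | predC small A].
have loE : map (fun A : {set 'I_d} => #|A|) lo = nseq (size lo) (d %/ n).
  rewrite -(size_map (fun A : {set 'I_d} => #|A|)); apply/all_pred1P/allP => c /mapP[A].
  by rewrite mem_filter => /andP[sA _] ->; exact: sA.
have hiE : map (fun A : {set 'I_d} => #|A|) hi = nseq (size hi) (d %/ n).+1.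
  rewrite -(size_map (fun A : {set 'I_d} => #|A|)); apply/all_pred1P/allP => c /mapP[A].
  rewrite mem_filter mem_enum => /andP[/= nsA AP] -> /=.
  by have := PA A AP; rewrite -/(small A) (negbTE nsA).
have lohi : perm_eq (lo ++ hi) (enum P) by rewrite perm_filterC.
have sz : size lo + size hi = n.
  by rewrite -size_cat (perm_size lohi) -cardE.
have dE : d = size lo * (d %/ n) + size hi * (d %/ n).+1.
  rewrite -[LHS]card_ord -cardsT (card_partition Pp) -big_enum/=.
  rewrite -(perm_big _ lohi) big_cat/= [in RHS]mulnC [size hi * _]mulnC.
  by rewrite -!sumn_nseq -loE -hiE !sumnE !big_map.
have hid : size hi = d %% n.
  have := divn_eq d n; have := ltn_pmod d n0; nia.
have lod : size lo = n - d %% n by lia.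
pose ss := map (fun A : {set 'I_d} => enum A) (lo ++ hi).
have shE : shape ss = equal_shape n.
  rewrite /shape -map_comp (eq_map (g := fun A : {set 'I_d} => #|A|)).
    by rewrite map_cat loE hiE lod hid.
  by move=> A; rewrite /= -cardE.
have iss i : i \in flatten ss.
  apply/flatten_mapP; exists (finset.pblock P i).
    by rewrite (perm_mem lohi) mem_enum finset.pblock_mem// (cover_partition Pp) finset.in_setT.
  by rewrite mem_enum finset.mem_pblock (cover_partition Pp) finset.in_setT.
exists ss; split => //.
- apply: uniq_perm; rewrite ?enum_uniq//; last by move=> i; rewrite iss mem_enum.
  apply: (@leq_size_uniq _ (enum 'I_d)); first exact: enum_uniq.
    by move=> i _; exact: iss.
  rewrite size_flatten shE sumn_cat !sumn_nseq size_enum_ord.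
  by rewrite [leqRHS]dE hid lod mulnC [_.+1 * _]mulnC.
- move=> A; rewrite -map_comp.
  rewrite (eq_map (g := id)); last by move=> B /=; rewrite set_enum.
  by rewrite map_id (perm_mem lohi) mem_enum.
Qed.

(** Enumerations of the same shape are matched entry by entry. *)
Lemma equal_partitions_transitive n P Q : 0 < n ->
  P \in equal_partitions n -> Q \in equal_partitions n ->
  exists s, Q = permute_blocks s P.
Proof.
move=> n0 /(equal_partition_enum n0)[ss [sss pss Pss]].
move=> /(equal_partition_enum n0)[tt [stt ptt Qtt]].
pose s := flatten ss; pose t := flatten tt.
have ms i : i \in s by rewrite (perm_mem pss) mem_enum.
have us : uniq s by rewrite (perm_uniq pss) enum_uniq.
have ut : uniq t by rewrite (perm_uniq ptt) enum_uniq.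
have st : size s = size t by rewrite (perm_size pss) (perm_size ptt).
pose f i := nth i t (index i s).
have f_inj : injective f.
  move=> i j; rewrite /f (set_nth_default i) -?st ?index_mem// => /eqP.
  rewrite nth_uniq -?st ?index_mem// => /eqP /(congr1 (nth i s)).
  by rewrite nth_index// (set_nth_default j) ?index_mem// nth_index.
have fs : map f s = t.
  case sE: s => [|i0 s']; first by apply/esym/size0nil; rewrite -st sE.
  rewrite -sE; apply: (@eq_from_nth _ i0); rewrite size_map// => k ks.
  rewrite (nth_map i0)// /f index_uniq//.
  by apply: set_nth_default; rewrite -st.
exists (perm f_inj); apply/setP => A; rewrite Qtt.
have -> : tt = map (map f) ss.
  by rewrite -(flattenK tt) stt -sss -/t -fs -map_reshape flattenK.
rewrite -map_comp; apply/mapP/imsetP => [[b bss ->]|[B]].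
  exists [set x in b]%SET; first by rewrite Pss; apply: map_f.
  apply/setP => i; rewrite inE; apply/mapP/imsetP => [[j jb ->]|[j]].
    by exists j; rewrite ?inE// permE.
  by rewrite inE => jb ->; exists j; rewrite ?permE.
rewrite Pss => /mapP[b bss ->] ->; exists b => //.
apply/setP => i; rewrite /= inE; apply/imsetP/mapP => [[j]|[j jb ->]].
  by rewrite inE => jb ->; exists j; rewrite ?permE.
by exists j; rewrite ?inE// permE.
Qed.

End EqualPartitions.

(** * Partitions into intervals *)

Section IntervalPartition.
Context {d : nat}.

(** Cutting at the multiples of $d / n$, whether or not $n$ divides $d$, keeps
    partitions for different $n$ nearly nested. *)
Definition interval_index n (i : 'I_d) : nat := i * n %/ d.

Definition interval_block n (w : nat) : {set 'I_d} :=
  [set i : 'I_d | interval_index n i == w]%SET.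

Definition interval_partition n : {set {set 'I_d}} :=
  [set interval_block n (val w) | w : 'I_n]%SET.

Lemma interval_index_lt n (i : 'I_d) : 0 < n -> interval_index n i < n.
Proof.
move=> n0; have id := ltn_ord i; have d0 : 0 < d by exact: leq_trans id.
by rewrite /interval_index ltn_divLR// mulnC ltn_pmul2l.
Qed.

Lemma card_ord_interval a b : b <= d ->
  #|[set i : 'I_d | a <= i < b]%SET| = b - a.
Proof.
move=> bd; rewrite -sum1_card.
rewrite (eq_bigl (fun i : 'I_d => (a <= i) && (i < b))); last first.
  by move=> i; rewrite inE.
rewrite -(big_ord_widen_cond _ (fun i => a <= i) (fun=> 1) bd).
rewrite -(@big_geq_mkord nat 0 addn a b xpredT (fun=> 1)).
by rewrite sum_nat_const_nat muln1.
Qed.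

(** The block runs from the ceiling of $w d / n$ to that of $(w + 1) d / n$. *)
Lemma card_interval_block n w : 0 < n <= d -> w < n ->
  d %/ n <= #|interval_block n w| <= (d %/ n).+1.
Proof.
move=> /andP[n0 nd] wn; have d0 : 0 < d by exact: leq_trans nd.
pose c w := (w * d + n.-1) %/ n.
have cP u (i : 'I_d) : (c u <= i) = (u <= interval_index n i).
  rewrite /c /interval_index leq_divRL// -ltnS ltn_divLR//.
  by apply/idP/idP; nia.
have cd : c w.+1 <= d.
  rewrite /c -ltnS ltn_divLR//; nia.
have -> : interval_block n w = [set i : 'I_d | c w <= i < c w.+1]%SET.
  apply/setP => i; rewrite !inE cP ltnNge cP -ltnNge ltnS.
  by rewrite eqn_leq andbC.
rewrite card_ord_interval//.
have h1 : c w + d %/ n <= c w.+1.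
  rewrite [c w + _]addnC /c -divnMDl// leq_div2r//.
  by have := leq_trunc_div d n; nia.
have h2 : c w.+1 <= c w + (d %/ n).+1.
  rewrite [c w + _]addnC /c -divnMDl// leq_div2r//.
  by have := ltn_ceil d n0; nia.
lia.
Qed.

Lemma interval_partition_equal n : 0 < n <= d ->
  interval_partition n \in equal_partitions n.
Proof.
move=> nd; have /andP[n0 nled] := nd.
have d0 : 0 < d by exact: leq_trans nled.
have := @indexed_partition 'I_n 'I_d predT (fun w => interval_block n (val w)).
case=> [u v _ _ uv|u _|Pp Binj].
- rewrite -setI_eq0; apply/eqP/setP => i; rewrite !inE.
  apply/negP => /andP[/eqP iu /eqP iv].
  by move: uv; rewrite -val_eqE/= -iu -iv eqxx.
- rewrite -card_gt0; have /andP[+ _] := card_interval_block nd (ltn_ord u).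
  by apply: leq_trans; rewrite divn_gt0.
apply/equal_partitionsP; split.
- rewrite (_ : [set: 'I_d]%SET = finset.cover (interval_partition n))//.
  apply/setP => i; rewrite finset.in_setT; apply/esym/bigcupP.
  exists (interval_block n (Ordinal (interval_index_lt i n0))).
    by apply/imsetP; exists (Ordinal (interval_index_lt i n0)).
  by rewrite inE.
- by rewrite card_in_imset ?card_ord// => u v _ _; apply: Binj.
move=> _ _ /imsetP[u _ ->] /imsetP[v _ ->].
have /andP[_ h1] := card_interval_block nd (ltn_ord u).
have /andP[h2 _] := card_interval_block nd (ltn_ord v).
exact: leq_trans h1 _.
Qed.

Local Open Scope ring_scope.
Context {R : realType}.

Lemma card_equal_partitions_gt0 n : (0 < n <= d)%N ->
  0 < #|@equal_partitions d n|%:R :> R.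
Proof.
move=> nd; rewrite ltr0n; apply/card_gt0P; exists (interval_partition n).
exact: interval_partition_equal.
Qed.

(** All equal partitions being conjugate, the mean over the permutations of a
    given one does not depend on it. The interval partition is chosen as
    representative because it makes different $n$ comparable. *)
Lemma mean_partitionE n (F : {set {set 'I_d}} -> R) : (0 < n <= d)%N ->
  mean_partition n F =
  (\sum_(s : {perm 'I_d}) F (permute_blocks s (interval_partition n))) /
    #|{perm 'I_d}|%:R.
Proof.
move=> nd; have /andP[n0 _] := nd.
have E0 := card_equal_partitions_gt0 nd.
have S0 : 0 < #|{perm 'I_d}|%:R :> R.
  by rewrite ltr0n; apply/card_gt0P; exists 1%g.
have inv (s : {perm 'I_d}) : \sum_(P in equal_partitions n) F P =
    \sum_(P in equal_partitions n) F (permute_blocks s P).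
  have bij : bijective (permute_blocks s).
    exists (permute_blocks s^-1) => P; rewrite -permute_blocksM ?mulgV ?mulVg;
    exact: permute_blocks1.
  rewrite (reindex (permute_blocks s)); last exact: onW_bij.
  apply: eq_bigl => P; apply/idP/idP; last exact: permute_blocks_equal.
  move=> /(permute_blocks_equal s^-1); rewrite -permute_blocksM mulgV.
  by rewrite permute_blocks1.
have each P : P \in equal_partitions n ->
    \sum_(s : {perm 'I_d}) F (permute_blocks s P) =
    \sum_(s : {perm 'I_d}) F (permute_blocks s (interval_partition n)).
  move=> Pn; have [t ->] := equal_partitions_transitive n0
    (interval_partition_equal nd) Pn.
  rewrite [RHS](reindex_inj (mulgI t)); apply: eq_bigr => s _.
  by rewrite permute_blocksM.
rewrite /mean_partition; apply/eqP.
rewrite eqr_div ?lt0r_neq0//; apply/eqP.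
transitivity (\sum_(s : {perm 'I_d}) \sum_(P in equal_partitions n) F P).
  by rewrite sumr_const mulr_natr.
rewrite (eq_bigr _ (fun s _ => inv s)) exchange_big/= (eq_bigr _ each).
by rewrite sumr_const mulr_natr.
Qed.

End IntervalPartition.

Local Open Scope classical_set_scope.
Local Open Scope ring_scope.

(** * Uniform convexity of powers *)

Section RealInequalities.
Context {R : realType}.

Lemma sum_cauchy_schwarz (I : finType) (P : pred I) (a b : I -> R) :
  (\sum_(i | P i) a i * b i) ^+ 2 <=
  (\sum_(i | P i) a i ^+ 2) * (\sum_(i | P i) b i ^+ 2).
Proof.
set A := \sum_(i | _) a i ^+ 2; set B := \sum_(i | _) b i ^+ 2.
set X := \sum_(i | _) _.
have A0 : 0 <= A by apply: sumr_ge0 => i _; exact: sqr_ge0.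
have q (l : R) : 0 <= A - 2 * l * X + l ^+ 2 * B.
  have -> : A - 2 * l * X + l ^+ 2 * B = \sum_(i | P i) (a i - l * b i) ^+ 2.
    rewrite /A /B /X !mulr_sumr -sumrB -big_split /=.
    by apply: eq_bigr => i _; ring.
  by apply: sumr_ge0 => i _; exact: sqr_ge0.
have B0 : 0 <= B by apply: sumr_ge0 => i _; exact: sqr_ge0.
have [B_eq0|Bn0] := eqVneq B 0.
  have X0 : X = 0.
    apply: big1 => i Pi.
    move: B_eq0 => /eqP; rewrite psumr_eq0; last by move=> ? _; exact: sqr_ge0.
    by move=> /allP/(_ i (mem_index_enum _)); rewrite Pi sqrf_eq0 => /eqP ->; rewrite mulr0.
  by rewrite X0 B_eq0 expr0n mulr0.
have Bp : 0 < B by rewrite lt_neqAle eq_sym Bn0.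
(* The least value of the quadratic polynomial [q] is attained at [X / B]. *)
have := q (X / B).
have -> : A - 2 * (X / B) * X + (X / B) ^+ 2 * B = (A * B - X ^+ 2) / B by field.
by rewrite pmulr_lge0 ?invr_gt0// subr_ge0.
Qed.

(** Young's inequality for the conjugate exponents $p$ and $p / (p - 1)$. *)
Lemma powR_ge_tangent (p a y : R) : 1 <= p -> 0 < a -> 0 <= y ->
  a `^ p + p * a `^ (p - 1) * (y - a) <= y `^ p.
Proof.
move=> p1 a0 y0.
have [->|pn1] := eqVneq p 1.
  by rewrite subrr powRr0 (powRr1 (ltW a0)) (powRr1 y0); lra.
have pgt1 : 1 < p by rewrite lt_neqAle eq_sym pn1.
have p0 : 0 < p by lra.
have r0 : 0 < p - 1 by lra.
have := @conjugate_powR _ y (a `^ (p - 1)) p (p / (p - 1)) y0 (powR_ge0 _ _) p0.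
rewrite divr_gt0// => /(_ isT).
have -> : p^-1 + (p / (p - 1))^-1 = 1 by field; apply/andP; split; lra.
move=> /(_ erefl).
rewrite -powRrM.
have -> : (p - 1) * (p / (p - 1)) = p by field; lra.
have -> : a `^ p = a * a `^ (p - 1).
  by rewrite -{2}(powRr1 (ltW a0)) -powRD ?subrKC// lt0r_neq0// implybT.
set A := a `^ _ => h.
have -> : a * A + p * A * (y - a) = p * (y * A - a * A / (p / (p - 1))).
  by field; apply/andP; split; lra.
rewrite -ler_pdivlMl//; lra.
Qed.

(** The tangent of the convex power $1 / r$, solved for $y^r$. *)
Lemma powR_le_tangent (r a y : R) : 0 <= r <= 1 -> 0 < a -> 0 <= y ->
  y `^ r <= a `^ r + r * a `^ (r - 1) * (y - a).
Proof.
move=> /andP[r0 r1] a0 y0.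
have [->|rn0] := eqVneq r 0; first by rewrite !powRr0 !mul0r addr0.
have rp : 0 < r by rewrite lt_neqAle eq_sym rn0.
have := @powR_ge_tangent r^-1 (a `^ r) (y `^ r).
rewrite invf_ge1// r1 powR_gt0// powR_ge0 => /(_ isT isT isT).
rewrite -!powRrM mulfV// (powRr1 (ltW a0)) (powRr1 y0).
have -> : r * (r^-1 - 1) = 1 - r by field.
have -> : 1 - r = - (r - 1) by ring.
rewrite powRN => h.
have A0 : 0 < a `^ (r - 1) by exact: powR_gt0.
have {}h : (y `^ r - a `^ r) / (r * a `^ (r - 1)) <= y - a.
  rewrite invfM mulrC; lra.
move: h; rewrite ler_pdivrMr ?mulr_gt0// mulrC; lra.
Qed.

(** Convexity only gives the tangents at $m$. Taking the tangents at the points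
    halfway from $m$ to $s$ and to $t$ for the second half of each way gains the
    difference of their slopes, which the concavity of the power $p - 1$ bounds
    below. The factor $p - 1$ is the right one as $p$ tends to 1. *)
Lemma powR_midpoint (p s t : R) (m := (s + t) / 2) :
  1 < p <= 2 -> 0 <= s -> 0 <= t -> 0 < m ->
  m `^ p + (p - 1) / 32 * (s - t) ^+ 2 * m `^ (p - 2) <= (s `^ p + t `^ p) / 2.
Proof.
move=> /andP[p1 p2].
wlog st : s t @m / t <= s => [hw s0 t0 m0|s0 t0 m0].
  have [|/ltW ts] := leP t s; first by move=> /hw; exact.
  have := hw t s ts t0 s0; rewrite [t + s]addrC -/m => /(_ m0).
  by rewrite -sqrrN opprB [t `^ p + _]addrC.
pose d := (s - t) / 4.
have d0 : 0 <= d by rewrite /d; lra.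
have tm1 := @powR_ge_tangent p (m + d) s (ltW p1) _ s0.
have tm2 := @powR_ge_tangent p m (m + d) (ltW p1) m0 _.
have tm3 := @powR_ge_tangent p (m - d) t (ltW p1) _ t0.
have tm4 := @powR_ge_tangent p m (m - d) (ltW p1) m0 _.
have md : 0 < m - d by rewrite /m /d; rewrite /m in m0; lra.
have md' : 0 < m + d by lra.
have {}tm1 := tm1 md'; have {}tm2 := tm2 (ltW md').
have {}tm3 := tm3 md; have {}tm4 := tm4 (ltW md).
have up : m `^ (p - 1) <= (m + d) `^ (p - 1).
  by apply: ge0_ler_powR; rewrite ?nnegrE; lra.
have dn := @powR_le_tangent (p - 1) m (m - d) _ m0 (ltW md).
have {}dn := dn ltac:(apply/andP; split; lra).
rewrite -addrA -opprD (_ : 1 + 1 = 2 :> R)// in dn.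
have sE : s - (m + d) = d by rewrite /m /d; field.
have tE : t - (m - d) = - d by rewrite /m /d; field.
rewrite sE in tm1; rewrite tE in tm3.
have E2 : m + d - m = d by ring.
have E4 : m - d - m = - d by ring.
rewrite E2 in tm2; rewrite E4 in tm4 dn.
have -> : (s - t) ^+ 2 = 16 * d ^+ 2 by rewrite /d; field.
set U := (m + d) `^ (p - 1) in tm1 up *; set V := (m - d) `^ (p - 1) in tm3 dn *.
set W := m `^ (p - 1) in up dn tm2 tm4.
set Z := m `^ (p - 2) in dn *.
have Z0 : 0 <= Z by exact: powR_ge0.
have k1 : p * d * (p - 1) * Z * d <= p * d * (U - V).
  have e : 0 <= U - V - (p - 1) * Z * d by lra.
  have : 0 <= p * d * (U - V - (p - 1) * Z * d) by rewrite !mulr_ge0//; lra.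
  by rewrite mulrBr !mulrA subr_ge0.
have k2 : (p - 1) * d ^+ 2 * Z <= p * d * (p - 1) * Z * d.
  have -> : p * d * (p - 1) * Z * d = p * ((p - 1) * d ^+ 2 * Z) by ring.
  rewrite ler_peMl//; last exact: ltW.
  by rewrite !mulr_ge0// ?sqr_ge0//; lra.
have := tm1; have := tm2; have := tm3; have := tm4.
rewrite (_ : (p - 1) / 32 * (16 * d ^+ 2) * Z = (p - 1) * d ^+ 2 * Z / 2);
  last by field.
move: k1 k2; rewrite !mulrBr !mulrN.
have -> : p * U * d = p * d * U by ring.
have -> : p * V * d = p * d * V by ring.
lra.
Qed.

(** For vectors $a$, $b$ of norms $s$, $t$, with $q$ the norm of the midpoint and
    $D$ that of $a - b$; the equation is the parallelogram law. It splits
    $D^2$ into $(s - t)^2$, handled by the scalar case, and $4 (m^2 - q^2)$,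
    handled by the concavity of the power $p / 2$ of squared norms. *)
Lemma powR_norm_midpoint (p s t q D : R) (m := (s + t) / 2) :
  1 < p <= 2 -> 0 <= s -> 0 <= t -> 0 <= q -> q <= m -> 0 < m ->
  D ^+ 2 = 2 * s ^+ 2 + 2 * t ^+ 2 - 4 * q ^+ 2 ->
  q `^ p + (p - 1) / 32 * (D ^+ 2 * m `^ (p - 2)) <= (s `^ p + t `^ p) / 2.
Proof.
move=> p12 s0 t0 q0 qm m0 DE.
have /andP[p1 p2] := p12.
have mid := powR_midpoint p12 s0 t0 m0.
rewrite -/m in mid.
have := @powR_le_tangent (p / 2) (m ^+ 2) (q ^+ 2).
rewrite exprn_gt0// sqr_ge0 => /(_ ltac:(apply/andP; split; lra) isT isT).
have m_ge0 := ltW m0.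
rewrite -(powR_mulrn _ m_ge0) -(powR_mulrn _ q0) -!powRrM.
rewrite (_ : 2%:R * (p / 2) = p); last by field.
rewrite (_ : 2%:R * (p / 2 - 1) = p - 2); last by field.
rewrite !powR_mulrn//.
set Z := m `^ (p - 2) in mid *; have Z0 : 0 <= Z by exact: powR_ge0.
have DE' : D ^+ 2 = (s - t) ^+ 2 + 4 * (m ^+ 2 - q ^+ 2) by rewrite DE /m; field.
have k : 0 <= m ^+ 2 - q ^+ 2 by rewrite subr_ge0 ler_sqr ?nnegrE// ltW.
have k2 : 0 <= (p / 2 - (p - 1) / 8) * (Z * (m ^+ 2 - q ^+ 2)).
  by rewrite !mulr_ge0//; lra.
rewrite DE'; move: mid k2; set X := (s - t) ^+ 2; set Y := m ^+ 2 - q ^+ 2.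
rewrite (_ : q ^+ 2 - m ^+ 2 = - Y) ; last by rewrite /Y opprB.
move=> mid k2 tg.
have -> : (p - 1) / 32 * ((X + 4 * Y) * Z) =
  (p - 1) / 32 * X * Z + (p - 1) / 8 * (Z * Y) by field.
move: k2; rewrite mulrBl; move: tg; rewrite mulrN -mulrA; lra.
Qed.

(** Linearizes $D^2 m^{-s}$ in $D$, so that sums over blocks need no division by
    powers of block norms that may vanish. *)
Lemma quad_young (l D m s : R) : 0 <= D -> 0 < m ->
  2 * l * D - l ^+ 2 * m `^ s <= D ^+ 2 * m `^ (- s).
Proof.
move=> D0 m0; rewrite powRN; set Z := m `^ s.
have Z0 : 0 < Z by exact: powR_gt0.
rewrite -subr_ge0.
have -> : D ^+ 2 / Z - (2 * l * D - l ^+ 2 * Z) = (D - l * Z) ^+ 2 / Z.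
  by field; rewrite gt_eqF.
by rewrite divr_ge0 ?sqr_ge0// ltW.
Qed.

End RealInequalities.

(** * Convex functions *)

Section Convexity.
Context {R : realType} {d : nat}.
Implicit Types (K : set 'rV[R]_d) (f : 'rV[R]_d -> R) (x y z : 'rV[R]_d).

Lemma convex_set_comb K t x y : convex_set K -> K x -> K y -> 0 <= t <= 1 ->
  K (t *: x + (1 - t) *: y).
Proof.
move=> Kc Kx Ky /andP[t0 t1].
have := Kc x y (Itv01 t0 t1); rewrite !inE => /(_ Kx Ky).
by [].
Qed.

Lemma convex_function_comb K f t x y : convex_function K (f : 'rV[R]_d -> R^o) ->
  K x -> K y -> 0 <= t <= 1 ->
  f (t *: x + (1 - t) *: y) <= t * f x + (1 - t) * f y.
Proof.
move=> fc Kx Ky /andP[t0 t1].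
by have := fc (Itv01 t0 t1) x y; rewrite !inE => /(_ Kx Ky).
Qed.

(** Normalizing by the partial sums of the weights is what lets the induction
    go through. *)
Lemma jensen_seq K f (I : eqType) (r : seq I) (w : I -> R) (x : I -> 'rV[R]_d) :
  convex_set K -> convex_function K (f : 'rV[R]_d -> R^o) ->
  (forall i, 0 < w i) -> (forall i, K (x i)) -> r != [::] ->
  let W := \sum_(i <- r) w i in
  [/\ 0 < W, K (W^-1 *: \sum_(i <- r) w i *: x i) &
  f (W^-1 *: \sum_(i <- r) w i *: x i) <= W^-1 * \sum_(i <- r) w i * f (x i)].
Proof.
move=> Kc fc w0 Kx; elim: r => // i [|j r] IH _ /=.
  rewrite !big_seq1 scalerA mulrA mulVf ?gt_eqF// scale1r mul1r.
  by split.
have [//|W0 KW fW] := IH.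
rewrite big_cons [\sum_(_ <- i :: _) _ *: _]big_cons [\sum_(_ <- i :: _) _ * _]big_cons.
move: W0 KW fW.
set W := \sum_(_ <- j :: r) w _; set S := \sum_(_ <- j :: r) _ *: _.
set F := \sum_(_ <- j :: r) _ * _ => W0 KW fW.
have WiW : 0 < w i + W by rewrite addr_gt0.
have t01 : 0 <= w i / (w i + W) <= 1.
  by apply/andP; split; [rewrite divr_ge0// ltW | rewrite ler_pdivrMr// mul1r lerDl ltW].
have tE : 1 - w i / (w i + W) = W / (w i + W) by field; rewrite gt_eqF.
have E : (w i + W)^-1 *: (w i *: x i + S) =
    (w i / (w i + W)) *: x i + (1 - w i / (w i + W)) *: (W^-1 *: S).
  rewrite tE scalerA mulrAC mulfV ?gt_eqF// mul1r scalerDr scalerA.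
  by rewrite [in X in X *: _ + _ = _]mulrC.
rewrite E; split => //; first exact: convex_set_comb.
apply: le_trans (convex_function_comb fc (Kx i) KW t01) _.
rewrite tE mulrDr; apply: lerD; first by rewrite mulrA [(w i + W)^-1 * _]mulrC.
have q0 : 0 <= W / (w i + W) by rewrite divr_ge0// ltW.
apply: le_trans (ler_wpM2l q0 fW) _.
by rewrite le_eqVlt; apply/orP; left; apply/eqP; field; rewrite !gt_eqF.
Qed.

Lemma jensen K f (I : finType) (w : I -> R) (x : I -> 'rV[R]_d) :
  convex_set K -> convex_function K (f : 'rV[R]_d -> R^o) ->
  (forall i, 0 < w i) -> \sum_i w i = 1 -> (forall i, K (x i)) ->
  K (\sum_i w i *: x i) /\ f (\sum_i w i *: x i) <= \sum_i w i * f (x i).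
Proof.
move=> Kc fc w0 w1 Kx.
have : index_enum I != [::].
  apply/eqP => I0; move: w1; rewrite I0 big_nil => /esym/eqP.
  by rewrite oner_eq0.
move=> /(jensen_seq Kc fc w0 Kx)/=; rewrite w1 invr1 !scale1r mul1r.
by case.
Qed.

Lemma grad_dotp f x v : differentiable (f : 'rV[R]_d -> R^o) x ->
  dotp (grad f x) v = 'D_v (f : 'rV[R]_d -> R^o) x.
Proof.
move=> fx; rewrite deriveE// [in RHS](row_sum_delta v) linear_sum /=.
by apply: eq_bigr => i _; rewrite linearZ/= mxE deriveE// mulrC.
Qed.

(** The difference quotients in the direction $z - x$ are at most $f(z) - f(x)$. *)
Lemma convex_grad_le K f x z : convex_function K (f : 'rV[R]_d -> R^o) ->
  differentiable (f : 'rV[R]_d -> R^o) x -> K x -> K z ->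
  dotp (grad f x) (z - x) <= f z - f x.
Proof.
move=> fc fx Kx Kz; rewrite grad_dotp//.
have /cvg_dnbhs_at_right cv := @diff_derivable _ _ _ _ _ (z - x) fx.
apply: (cvgr_to_le cv).
near=> t; rewrite /= /GRing.scale/=.
have t0 : 0 < t by near: t; exact: nbhs_right_gt.
have t1 : t <= 1 by near: t; apply: nbhs_right_ltW.
rewrite -ler_pdivlMl ?invr_gt0// invrK.
have -> : t *: (z - x) + x = t *: z + (1 - t) *: x.
  by rewrite scalerBr scalerBl scale1r -addrA [- _ + _]addrC.
have := convex_function_comb fc Kz Kx (t := t).
rewrite t1 ltW// => /(_ isT); lra.
Unshelve. all: by end_near. Qed.

End Convexity.

(** * The Hedge forecaster *)

Section Hedge.
Context {R : realType} {I : finType}.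
Variables (eps : R) (l : I -> nat -> R).

Definition hedge_potential t i : R := expR (- (eps * \sum_(s < t) l i s)).
Definition hedge_weight t i : R :=
  hedge_potential t i / \sum_j hedge_potential t j.

Lemma hedge_total_gt0 t (i0 : I) : 0 < \sum_j hedge_potential t j.
Proof.
rewrite (bigD1 i0)//= ltr_pwDl ?expR_gt0//.
by apply: sumr_ge0 => i _; exact: expR_ge0.
Qed.

Lemma hedge_weight_gt0 t i : 0 < hedge_weight t i.
Proof. by rewrite divr_gt0 ?expR_gt0// hedge_total_gt0. Qed.

Lemma hedge_weight_sum1 t (i0 : I) : \sum_i hedge_weight t i = 1.
Proof. by rewrite -mulr_suml mulfV// gt_eqF// hedge_total_gt0. Qed.

Lemma expRN_le_quad (a : R) : 0 <= a -> expR (- a) <= 1 - a + a ^+ 2.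
Proof.
move=> a0; rewrite expRN -[leLHS]mul1r ler_pdivrMr ?expR_gt0//.
apply: (@le_trans _ _ ((1 - a + a ^+ 2) * (1 + a))).
  have -> : (1 - a + a ^+ 2) * (1 + a) = 1 + a ^+ 3 by ring.
  by rewrite lerDl exprn_ge0.
apply: ler_wpM2l; last exact: expR_ge1Dx.
have -> : 1 - a + a ^+ 2 = (1 - a / 2) ^+ 2 + 3 / 4 * a ^+ 2 by field.
have := sqr_ge0 (1 - a / 2); have := sqr_ge0 a; lra.
Qed.

Variable rho : R.
Hypothesis eps0 : 0 < eps.
Hypothesis l_range : forall i j t, l i t - l j t <= rho.

(** Subtracting the least loss of the round changes no weight and puts the losses
    in $[0, rho]$, where $e^{-a} <= 1 - a + a^2$ applies. *)
Lemma hedge_potential_step t (i0 : I) :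
  \sum_i hedge_potential t.+1 i <= (\sum_i hedge_potential t i) *
    expR (- (eps * \sum_i hedge_weight t i * l i t) + (eps * rho) ^+ 2).
Proof.
have [j _ jmin] := @arg_minP _ _ I i0 xpredT (fun i => l i t) isT.
have step i : hedge_potential t.+1 i = hedge_potential t i * expR (- (eps * l i t)).
  by rewrite /hedge_potential -expRD big_ord_recr/= mulrDr opprD.
set Z := \sum_i hedge_potential t i.
have Z0 : 0 < Z by exact: hedge_total_gt0.
pose a i := l i t - l j t.
have a0 i : 0 <= a i by rewrite subr_ge0 jmin.
have arho i : eps * a i <= eps * rho by rewrite ler_wpM2l ?l_range// ltW.
have ub i : hedge_potential t.+1 i <= hedge_potential t i *
    (expR (- (eps * l j t)) * (1 - eps * a i + (eps * rho) ^+ 2)).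
  rewrite step; apply: ler_wpM2l; first exact: expR_ge0.
  have -> : - (eps * l i t) = - (eps * l j t) - eps * a i by rewrite /a; ring.
  rewrite expRD; apply: ler_wpM2l; first exact: expR_ge0.
  have ea0 : 0 <= eps * a i by rewrite mulr_ge0// ltW.
  apply: le_trans (expRN_le_quad ea0) _.
  by rewrite lerD2l ler_sqr ?nnegrE// (le_trans ea0).
apply: le_trans (ler_sum _ (fun i _ => ub i)) _.
have -> : \sum_i hedge_potential t i *
    (expR (- (eps * l j t)) * (1 - eps * a i + (eps * rho) ^+ 2)) =
  Z * (expR (- (eps * l j t)) *
    (1 + (- (eps * \sum_i hedge_weight t i * a i) + (eps * rho) ^+ 2))).
  transitivity (\sum_i Z * (expR (- (eps * l j t)) * (hedge_weight t i *
      (1 - eps * a i + (eps * rho) ^+ 2)))).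
    apply: eq_bigr => i _; rewrite [in LHS]mulrCA [in RHS]mulrCA; congr (_ * _).
    by rewrite mulrA /hedge_weight -/Z; congr (_ * _); field; rewrite gt_eqF.
  rewrite -!mulr_sumr; congr (_ * (_ * _)).
  under eq_bigr => i _ do rewrite mulrDr mulrBr mulr1 mulrCA.
  rewrite big_split/= sumrB/= (hedge_weight_sum1 t i0) -mulr_sumr -mulr_suml.
  by rewrite (hedge_weight_sum1 t i0) mul1r addrA.
apply: ler_wpM2l; first exact: ltW.
have -> : - (eps * \sum_i hedge_weight t i * l i t) + (eps * rho) ^+ 2 =
  - (eps * l j t) + (- (eps * \sum_i hedge_weight t i * a i) + (eps * rho) ^+ 2).
  rewrite addrA; congr (_ + _); rewrite -opprD -mulrDr; congr (- (_ * _)).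
  under [in RHS]eq_bigr => i _ do rewrite mulrBr.
  by rewrite sumrB/= -mulr_suml (hedge_weight_sum1 t i0) mul1r subrKC.
rewrite expRD; apply: ler_wpM2l; first exact: expR_ge0.
exact: expR_ge1Dx.
Qed.

(** The total potential dominates the potential of the expert $i$ and decays at
    the pace of the averaged loss. *)
Lemma hedge_regret T (i : I) :
  \sum_(t < T) \sum_j hedge_weight t j * l j t <=
  \sum_(t < T) l i t + ln #|I|%:R / eps + T%:R * (eps * rho ^+ 2).
Proof.
have tot t : \sum_j hedge_potential t j <= #|I|%:R * expR (- (eps *
    \sum_(s < t) \sum_j hedge_weight s j * l j s) + t%:R * (eps * rho) ^+ 2).
  elim: t => [|t IH].
    rewrite big_ord0 mulr0 oppr0 mul0r addr0 expR0 mulr1.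
    under eq_bigr => j _ do rewrite /hedge_potential big_ord0 mulr0 oppr0 expR0.
    by rewrite sumr_const.
  apply: le_trans (hedge_potential_step t i) _.
  apply: le_trans (ler_wpM2r (expR_ge0 _) IH) _.
  rewrite -mulrA -expRD big_ord_recr/= -natr1 le_eqVlt; apply/orP; left.
  by apply/eqP; congr (_ * expR _); ring.
have N0 : 0 < #|I|%:R :> R by rewrite ltr0n; apply/card_gt0P; exists i.
have := tot T; set S := \sum_(t < T) \sum_j _ => tT.
have : hedge_potential T i <= #|I|%:R * expR (- (eps * S) + T%:R * (eps * rho) ^+ 2).
  apply: le_trans tT; rewrite (bigD1 i)//= lerDl.
  by apply: sumr_ge0 => j _; exact: expR_ge0.
rewrite /hedge_potential -{1}(lnK N0) -expRD ler_expR; set L := \sum_(s < T) _.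
move=> h; rewrite -(ler_pM2l eps0).
have -> : eps * (L + ln #|I|%:R / eps + T%:R * (eps * rho ^+ 2)) =
  eps * L + ln #|I|%:R + T%:R * (eps * rho) ^+ 2 by field; rewrite gt_eqF.
lra.
Qed.

End Hedge.

(** * Block norms *)

Section BlockNormTheory.
Context {R : realType} {d : nat}.
Implicit Types (A : {set 'I_d}) (P : {set {set 'I_d}}) (x y z u v : 'rV[R]_d).

Definition midpoint x y : 'rV[R]_d := 2^-1 *: (x + y).

Lemma block_l2_ge0 A x : 0 <= block_l2 A x.
Proof. exact: sqrtr_ge0. Qed.

Lemma sqr_block_l2 A x : block_l2 A x ^+ 2 = \sum_(i in A) x 0 i ^+ 2.
Proof. by rewrite sqr_sqrtr// sumr_ge0// => i _; exact: sqr_ge0. Qed.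

Lemma block_l2_dot A x y :
  \sum_(i in A) x 0 i * y 0 i <= block_l2 A x * block_l2 A y.
Proof.
have [h|h] := ltP (\sum_(i in A) x 0 i * y 0 i) 0.
  by apply: le_trans (ltW h) _; rewrite mulr_ge0// block_l2_ge0.
rewrite -ler_sqr ?nnegrE ?mulr_ge0 ?block_l2_ge0//.
by rewrite exprMn !sqr_block_l2; exact: sum_cauchy_schwarz.
Qed.

Lemma block_l2Z A c x : block_l2 A (c *: x) = `|c| * block_l2 A x.
Proof.
rewrite /block_l2 -sqrtr_sqr -sqrtrM ?sqr_ge0// mulr_sumr.
by congr Num.sqrt; apply: eq_bigr => i _; rewrite mxE exprMn.
Qed.

Lemma block_l2N A x : block_l2 A (- x) = block_l2 A x.
Proof. by rewrite -scaleN1r block_l2Z normrN1 mul1r. Qed.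

Lemma block_l2D A x y : block_l2 A (x + y) <= block_l2 A x + block_l2 A y.
Proof.
rewrite -ler_sqr ?nnegrE ?addr_ge0 ?block_l2_ge0//.
have -> : block_l2 A (x + y) ^+ 2 = block_l2 A x ^+ 2 + block_l2 A y ^+ 2 +
    2 * \sum_(i in A) x 0 i * y 0 i.
  rewrite !sqr_block_l2 mulr_sumr -!big_split/=.
  by apply: eq_bigr => i _; rewrite mxE; ring.
have := block_l2_dot A x y; rewrite sqrrD; lra.
Qed.

Lemma block_l2_parallelogram A x y : block_l2 A (x - y) ^+ 2 =
  2 * block_l2 A x ^+ 2 + 2 * block_l2 A y ^+ 2 -
  4 * block_l2 A (midpoint x y) ^+ 2.
Proof.
rewrite !sqr_block_l2 !mulr_sumr -big_split/= -sumrB.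
by apply: eq_bigr => i _; rewrite !mxE; field.
Qed.

Lemma block_l2_midpoint_le A x y :
  block_l2 A (midpoint x y) <= (block_l2 A x + block_l2 A y) / 2.
Proof.
rewrite block_l2Z ger0_norm ?invr_ge0// mulrC ler_pM2r ?invr_gt0//.
exact: block_l2D.
Qed.

Lemma block_l2_eq0 A x i : block_l2 A x = 0 -> i \in A -> x 0 i = 0.
Proof.
move=> x0 iA; have /eqP := sqr_block_l2 A x; rewrite x0 expr0n/= eq_sym.
rewrite psumr_eq0; last by move=> j _; exact: sqr_ge0.
by move=> /allP/(_ i (mem_index_enum _)); rewrite iA sqrf_eq0 => /eqP.
Qed.

Lemma block_norm_ge0 P x : 0 <= block_norm P x.
Proof. by apply: sumr_ge0 => A _; exact: block_l2_ge0. Qed.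

Lemma block_normZ P c x : block_norm P (c *: x) = `|c| * block_norm P x.
Proof. by rewrite /block_norm mulr_sumr; apply: eq_bigr => A _; exact: block_l2Z. Qed.

Lemma block_normN P x : block_norm P (- x) = block_norm P x.
Proof. by apply: eq_bigr => A _; exact: block_l2N. Qed.

Lemma block_normD P x y : block_norm P (x + y) <= block_norm P x + block_norm P y.
Proof. by rewrite /block_norm -big_split; apply: ler_sum => A _; exact: block_l2D. Qed.

Lemma sum_blocks P (F : 'I_d -> R) : finset.partition P [set: 'I_d]%SET ->
  \sum_i F i = \sum_(A in P) \sum_(i in A) F i.
Proof.
move=> Pp; rewrite -(set_partition_big _ Pp).
by apply: eq_bigl => i; rewrite finset.in_setT.
Qed.

Lemma block_norm_gt0 P x : finset.partition P [set: 'I_d]%SET -> x != 0 ->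
  0 < block_norm P x.
Proof.
move=> Pp; apply: contraNT; rewrite -leNgt => N0; apply/eqP/rowP => i.
have /eqP : block_norm P x = 0 by apply/eqP; rewrite eq_le N0 block_norm_ge0.
rewrite psumr_eq0; last by move=> A _; exact: block_l2_ge0.
have iT : i \in finset.cover P by rewrite (cover_partition Pp) finset.in_setT.
have iB : i \in finset.pblock P i by rewrite finset.mem_pblock.
move=> /allP/(_ (finset.pblock P i) (mem_index_enum _)).
by rewrite finset.pblock_mem//= => /eqP/block_l2_eq0 ->//; rewrite mxE.
Qed.

Lemma block_dual_norm_ge0 P x : 0 <= block_dual_norm P x.
Proof. exact: bigmax_ge_id. Qed.

Lemma block_l2_le_dual P A x : A \in P -> block_l2 A x <= block_dual_norm P x.
Proof. by move=> AP; exact: (le_bigmax_cond _ (fun A => block_l2 A x) AP). Qed.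

Lemma dotp_le_dual P u v : finset.partition P [set: 'I_d]%SET ->
  dotp u v <= block_dual_norm P u * block_norm P v.
Proof.
move=> Pp; rewrite /dotp (sum_blocks _ Pp) mulr_sumr; apply: ler_sum => A AP.
apply: le_trans (block_l2_dot A u v) _.
by rewrite ler_wpM2r ?block_l2_ge0// block_l2_le_dual.
Qed.

Lemma block_l2_le_l2norm A x : block_l2 A x <= l2norm x.
Proof.
apply: ler_wsqrtr; rewrite [leRHS](bigID (mem A))/= lerDl.
by apply: sumr_ge0 => i _; exact: sqr_ge0.
Qed.

Lemma l2norm_ge0 x : 0 <= l2norm x. Proof. exact: sqrtr_ge0. Qed.

Lemma block_dual_le_l2norm P x : block_dual_norm P x <= l2norm x.
Proof.
by apply: bigmax_le => [|A _]; [exact: l2norm_ge0|exact: block_l2_le_l2norm].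
Qed.

Lemma sqr_l2norm_le_dual P x : finset.partition P [set: 'I_d]%SET ->
  l2norm x ^+ 2 <= #|P|%:R * block_dual_norm P x ^+ 2.
Proof.
move=> Pp; rewrite sqr_sqrtr; last by apply: sumr_ge0 => i _; exact: sqr_ge0.
rewrite (sum_blocks _ Pp) -sum1_card natr_sum mulr_suml; apply: ler_sum => A AP.
by rewrite mul1r -sqr_block_l2 ler_sqr ?nnegrE ?block_l2_ge0 ?block_dual_norm_ge0//
  block_l2_le_dual.
Qed.

End BlockNormTheory.

(** * Strong convexity of the mirror map *)

Section BlockExponent.
Context {R : realType}.

(** $e^{-1/6} >= 5/6$, and $(5/6)^6 >= 1/3$. *)
Lemma expR1_le3 : expR 1 <= 3 :> R.
Proof.
have h : 5 / 6 <= expR (- 6^-1) :> R.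
  by apply: le_trans (expR_ge1Dx _); lra.
have : (5 / 6) ^+ 6 <= expR (- 6^-1) ^+ 6 :> R.
  by apply: lerXn2r => //; rewrite nnegrE ?expR_ge0//; lra.
rewrite -expRM_natl mulrN mulfV// expRN => h6.
have : 3^-1 <= (expR 1)^-1 :> R by apply: le_trans h6; lra.
by rewrite lef_pV2 ?posrE ?expR_gt0.
Qed.

Lemma ln_ge1 (x : R) : 3 <= x -> 1 <= ln x.
Proof.
move=> x3; rewrite -(@expRK R 1) ler_ln ?posrE ?expR_gt0//.
  by apply: le_trans x3; exact: expR1_le3.
by apply: lt_le_trans x3.
Qed.

Lemma block_exponent_bounds n : (0 < n)%N -> 1 < (block_exponent n : R) <= 2.
Proof.
rewrite /block_exponent; case: (leqP n 2) => [_ _|n3 _]; first by apply/andP; split; lra.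
have l1 : 1 <= ln n%:R :> R by apply: ln_ge1; rewrite (ler_nat _ 3).
have l0 : 0 < ln n%:R :> R by lra.
have i1 : (ln n%:R)^-1 <= 1 :> R by rewrite invf_le1.
by rewrite ltrDl invr_gt0 l0/=; lra.
Qed.

Lemma block_gamma_gt0 n : (0 < n)%N -> 0 < block_gamma n :> R.
Proof.
rewrite /block_gamma; case: eqP => // n1; case: eqP => [_|n2] n0.
  by rewrite invr_gt0.
rewrite invr_gt0 mulr_gt0 ?expR_gt0// ln_gt0// (ltr_nat _ 1).
by case: n n1 n2 n0 => [|[|[]]].
Qed.

(** This identity is the purpose of the choice of $gamma_n$ and $p_n$: the factor
    $n^{p_n - 1}$ equals $e$ for $n >= 3$, and $gamma_n$ carries its inverse. *)
Lemma block_gammaE n : (0 < n)%N ->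
  block_exponent n - 1 = block_gamma n * n%:R `^ (block_exponent n - 1) :> R.
Proof.
rewrite /block_exponent /block_gamma.
case: n => [//|[|[|n]]] _ /=.
- by rewrite powR1 mul1r; ring.
- by rewrite (_ : 2 - 1 = 1) ?powRr1//; [field|ring].
have l0 : 0 < ln n.+3%:R :> R by rewrite ln_gt0// (ltr_nat _ 1).
have -> : 1 + (ln n.+3%:R)^-1 - 1 = (ln n.+3%:R)^-1 :> R by ring.
rewrite /powR gt_eqF// mulVf ?gt_eqF//.
by field; rewrite !gt_eqF// expR_gt0.
Qed.

End BlockExponent.

Section DistanceGeneratingFunction.
Context {R : realType} {d : nat}.
Implicit Types (A : {set 'I_d}) (P : {set {set 'I_d}}) (x y z u v : 'rV[R]_d).

Definition sum_powR P (p : R) x : R := \sum_(A in P) block_l2 A x `^ p.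

(** The gain is made affine in the norms of the block: in $D$ by [quad_young],
    whose parameter $l$ is common to all blocks, and in $m$ by the tangent of
    the power $2 - p$ at $1/n$, the mean of $m$ over the $n$ blocks of vectors of
    unit block norm. *)
Lemma block_powR_midpoint A (p l : R) x y
    (m := (block_l2 A x + block_l2 A y) / 2) (D := block_l2 A (x - y)) (n : R) :
  1 < p <= 2 -> 0 < n ->
  block_l2 A (midpoint x y) `^ p + (p - 1) / 32 * (2 * l * D -
    l ^+ 2 * (n^-1 `^ (2 - p) + (2 - p) * n^-1 `^ (1 - p) * (m - n^-1)))
  <= (block_l2 A x `^ p + block_l2 A y `^ p) / 2.
Proof.
move=> p12 n0; have /andP[p1 p2] := p12.
have s0 := block_l2_ge0 A x; have t0 := block_l2_ge0 A y.
have q0 := block_l2_ge0 A (midpoint x y); have D0 := block_l2_ge0 A (x - y).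
rewrite -/D in D0.
have qm := block_l2_midpoint_le A x y; rewrite -/m in qm.
have DE := block_l2_parallelogram A x y; rewrite -/D in DE.
have m_ge0 : 0 <= m by rewrite (le_trans q0).
set B := n^-1 `^ _ + _.
have mB : m `^ (2 - p) <= B.
  have := @powR_le_tangent R (2 - p) n^-1 m; rewrite invr_gt0 => /(_ _ n0 m_ge0).
  by rewrite (_ : 2 - p - 1 = 1 - p); [apply; apply/andP; split; lra|ring].
have B0 : 0 <= B by rewrite (le_trans _ mB)// powR_ge0.
have r0 : 0 <= (p - 1) / 32 by lra.
have [m0|mn] := eqVneq m 0.
  have sE : block_l2 A x = 0 by move: m0; rewrite /m; lra.
  have tE : block_l2 A y = 0 by move: m0; rewrite /m; lra.
  have qE : block_l2 A (midpoint x y) = 0 by lra.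
  have DE0 : D = 0.
    by apply/eqP; rewrite -sqrf_eq0 DE sE tE qE !expr0n/= !mulr0 addr0 subrr.
  rewrite DE0 qE sE tE powR0 ?gt_eqF//; last lra.
  by have := mulr_ge0 r0 (mulr_ge0 (sqr_ge0 l) B0); lra.
have m0 : 0 < m by rewrite lt_neqAle eq_sym mn.
apply: le_trans (powR_norm_midpoint p12 s0 t0 q0 qm m0 DE).
rewrite lerD2l; apply: ler_wpM2l => //.
rewrite -[X in m `^ X]opprB; apply: le_trans (quad_young l (2 - p) D0 m0).
by rewrite lerD2l lerN2; apply: ler_wpM2l => //; exact: sqr_ge0.
Qed.

Lemma sum_powR_midpoint P (p : R) x y : 1 < p <= 2 -> (0 < #|P|)%N ->
  block_norm P x <= 1 -> block_norm P y <= 1 ->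
  sum_powR P p (midpoint x y) +
    (p - 1) / 32 * (block_norm P (x - y) ^+ 2 / #|P|%:R `^ (p - 1)) <=
  (sum_powR P p x + sum_powR P p y) / 2.
Proof.
move=> p12 P0 x1 y1; have /andP[p1 p2] := p12.
set n : R := #|P|%:R; have n0 : 0 < n by rewrite ltr0n.
set S := block_norm P (x - y); set l := S / n `^ (p - 1).
have N0 : 0 < n `^ (p - 1) by exact: powR_gt0.
(* This [l] maximizes the sum of the lower bounds over the blocks. *)
rewrite /sum_powR -big_split/= mulr_suml.
apply: le_trans (ler_sum _ (fun A _ => block_powR_midpoint A l x y p12 n0)).
rewrite big_split/= lerD2l -mulr_sumr; apply: ler_wpM2l; first lra.
rewrite sumrB -!mulr_sumr -/(block_norm P (x - y)) -/S big_split/= sumr_const.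
rewrite -mulr_sumr sumrB sumr_const -mulr_suml big_split/=.
rewrite -/(block_norm P x) -/(block_norm P y).
rewrite -[n^-1 *+ _]mulr_natl mulfV ?gt_eqF//.
rewrite -[_ *+ #|P|]mulr_natl -/n.
have -> : n * n^-1 `^ (2 - p) = n `^ (p - 1).
  rewrite -powR_inv1 ?ltW// -powRrM -{1}(powRr1 (ltW n0)) -powRD.
    by congr (_ `^ _); ring.
  by rewrite (gt_eqF n0) implybT.
have M1 : (block_norm P x + block_norm P y) / 2 - 1 <= 0 by lra.
have : (2 - p) * n^-1 `^ (1 - p) * ((block_norm P x + block_norm P y) / 2 - 1) <= 0.
  by apply: mulr_ge0_le0 => //; rewrite mulr_ge0 ?powR_ge0//; lra.
move=> h; apply: (@le_trans _ _ (2 * l * S - l ^+ 2 * n `^ (p - 1))).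
  rewrite le_eqVlt; apply/orP; left; apply/eqP.
  by rewrite /l; field; rewrite gt_eqF.
by rewrite lerD2l lerN2; apply: ler_wpM2l; [exact: sqr_ge0|rewrite gerDl].
Qed.

(** The constant 64 is 32 from [powR_norm_midpoint] times the bound 2 on the
    exponent; nothing else remains by [block_gammaE]. *)
Lemma block_dgf_midpoint P x y : (0 < #|P|)%N ->
  block_norm P x <= 1 -> block_norm P y <= 1 ->
  block_dgf P (midpoint x y) + block_norm P (x - y) ^+ 2 / 64 <=
  (block_dgf P x + block_dgf P y) / 2.
Proof.
move=> P0 x1 y1; have p12 := @block_exponent_bounds R _ P0.
have /andP[p1 p2] := p12.
have g0 := @block_gamma_gt0 R _ P0; have gE := @block_gammaE R _ P0.
have := sum_powR_midpoint p12 P0 x1 y1.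
rewrite /block_dgf -/(sum_powR _ _ _) -/(sum_powR _ _ _) -/(sum_powR _ _ _).
move: gE p1 p2 g0.
set p := block_exponent #|P|; set g := block_gamma #|P|.
set n := #|P|%:R `^ _; set S := block_norm P (x - y).
move=> gE p1 p2 g0 h.
have n0 : 0 < n by apply: powR_gt0; rewrite ltr0n.
have gp : 0 < (g * p)^-1 by rewrite invr_gt0 mulr_gt0//; lra.
rewrite -mulrDr -mulrA; apply: le_trans (ler_wpM2l (ltW gp) h).
rewrite mulrDr lerD2l.
have -> : (g * p)^-1 * ((p - 1) / 32 * (S ^+ 2 / n)) = S ^+ 2 * (32 * p)^-1.
  rewrite gE; field; apply/and3P; split; rewrite gt_eqF//; lra.
apply: ler_wpM2l; first exact: sqr_ge0.
rewrite lef_pV2 ?posrE//; lra.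
Qed.

Lemma block_dgf_scaled_midpoint P (rho : R) x y : (0 < #|P|)%N -> 0 < rho ->
  block_norm P x <= rho -> block_norm P y <= rho ->
  block_dgf_scaled P rho (midpoint x y) + block_norm P (x - y) ^+ 2 / 64 <=
  (block_dgf_scaled P rho x + block_dgf_scaled P rho y) / 2.
Proof.
move=> P0 rho0 xr yr; rewrite /block_dgf_scaled.
have iv0 : 0 <= rho^-1 by rewrite invr_ge0 ltW.
have sc v : block_norm P v <= rho -> block_norm P (rho^-1 *: v) <= 1.
  by move=> vr; rewrite block_normZ ger0_norm// mulrC ler_pdivrMr// mul1r.
have := block_dgf_midpoint P0 (sc _ xr) (sc _ yr).
have -> : midpoint (rho^-1 *: x) (rho^-1 *: y) = rho^-1 *: midpoint x y.
  by rewrite /midpoint -scalerDr !scalerA mulrC.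
rewrite -scalerBr block_normZ ger0_norm// => h.
rewrite -mulrDr -mulrA; apply: le_trans (ler_wpM2l (sqr_ge0 rho) h).
rewrite mulrDr lerD2l le_eqVlt; apply/orP; left; apply/eqP.
by field; rewrite gt_eqF.
Qed.

End DistanceGeneratingFunction.

(** * Gradient of the mirror map and Bregman divergence *)

Section DgfGradient.
Context {R : realType} {d : nat}.
Implicit Types (A : {set 'I_d}) (P : {set {set 'I_d}}) (x y z u v : 'rV[R]_d).

(** For a convex function and a candidate subgradient the lower bound is free, so
    that only one upper estimate identifies a partial derivative. *)
Lemma derive_squeeze (F : 'rV[R]_d -> R) x v (g : R) (om : R -> R) :
  om s @[s --> 0^'+] --> 0 ->
  (forall t, 0 <= F (t *: v + x) - F x - t * g <= `|t| * om `|t|) ->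
  'D_v (F : 'rV[R]_d -> R^o) x = g.
Proof.
move=> om0 Fb; apply: cvg_lim => //.
have om0' : om `|t| @[t --> (0 : R)^'] --> (0 : R).
  have n0 : `|t| @[t --> (0 : R)^'] --> (0 : R)^'+.
    move=> A [e /= e0 eA]; exists e => //= t te tn0.
    apply: eA => /=; last by rewrite normr_gt0.
    by move: te; rewrite /= !sub0r !normrN normr_id.
  exact: (cvg_comp _ _ n0 om0).
apply/cvgrPdist_le => e e0.
have /cvgrPdist_le/(_ e e0) := om0'.
apply: filter_app; near=> t => /=.
have tn0 : t != 0 by near: t; exact: nbhs_dnbhs_neq.
rewrite sub0r normrN => oe.
rewrite /GRing.scale/=; have t0 : 0 < `|t| by rewrite normr_gt0.
have -> : g - t^-1 * (F (t *: v + x) - F x) =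
    - (t^-1 * (F (t *: v + x) - F x - t * g)) by field.
have /andP[Fb1 Fb2] := Fb t.
rewrite normrN normrM normfV (ger0_norm Fb1) ler_pdivrMl//.
apply: le_trans Fb2 _; rewrite ler_pM2l//.
by apply: le_trans oe; exact: ler_norm.
Unshelve. all: by end_near. Qed.

(** On a block where $x$ vanishes the power has base 0 and a nonpositive exponent, but
    it multiplies a zero coordinate. *)
Definition sum_powR_grad P (p : R) x : 'rV[R]_d :=
  \row_i (p * block_l2 (finset.pblock P i) x `^ (p - 2) * x 0 i).

Lemma sum_powR_grad_dotp P p x v : finset.partition P [set: 'I_d]%SET ->
  dotp (sum_powR_grad P p x) v = \sum_(A in P)
    p * block_l2 A x `^ (p - 2) * \sum_(i in A) x 0 i * v 0 i.
Proof.
move=> Pp; rewrite /dotp (sum_blocks _ Pp); apply: eq_bigr => A AP.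
rewrite mulr_sumr; apply: eq_bigr => i iA.
have /and3P[_ tI _] := Pp.
by rewrite mxE (def_pblock tI AP iA) mulrA.
Qed.

Lemma sqr_block_l2_line A x v (t : R) : block_l2 A (t *: v + x) ^+ 2 =
  block_l2 A x ^+ 2 + 2 * t * \sum_(i in A) x 0 i * v 0 i
  + t ^+ 2 * block_l2 A v ^+ 2.
Proof.
rewrite !sqr_block_l2 !mulr_sumr -!big_split/=.
by apply: eq_bigr => i _; rewrite !mxE; ring.
Qed.

Lemma powR_block_grad_le A (p : R) x z : 1 < p <= 2 ->
  p * block_l2 A x `^ (p - 2) * \sum_(i in A) x 0 i * (z - x) 0 i <=
  block_l2 A z `^ p - block_l2 A x `^ p.
Proof.
move=> /andP[p1 p2].
have a0 := block_l2_ge0 A x; have b0 := block_l2_ge0 A z.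
have -> : \sum_(i in A) x 0 i * (z - x) 0 i =
    \sum_(i in A) x 0 i * z 0 i - block_l2 A x ^+ 2.
  by rewrite sqr_block_l2 -sumrB; apply: eq_bigr => i _; rewrite !mxE; ring.
have [x0|xn0] := eqVneq (block_l2 A x) 0.
  rewrite x0 (@powR0 _ p); last by rewrite gt_eqF; lra.
  rewrite expr0n/= !subr0 big1 ?mulr0 ?powR_ge0// => i iA.
  by rewrite (block_l2_eq0 x0 iA) mul0r.
have xp : 0 < block_l2 A x by rewrite lt_neqAle eq_sym xn0.
have := powR_ge_tangent (ltW p1) xp b0.
have -> : p - 1 = p - 2 + 1 by ring.
rewrite powRD ?(gt_eqF xp) ?implybT// powRr1//.
have := block_l2_dot A x z; set Z := block_l2 A x `^ (p - 2); set X := \sum_(i in A) _.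
have Z0 : 0 <= p * Z by rewrite mulr_ge0 ?powR_ge0//; lra.
rewrite -subr_ge0 => /(mulr_ge0 Z0) h1 h2; rewrite -subr_ge0 in h2.
rewrite -subr_ge0; lra.
Qed.

(** If $x$ does not vanish on the block, the remainder is quadratic by concavity
    of the power $p / 2$ of the squared norm; if it does, it is the power $p$ of
    the increment. The sum of both remainders covers the two cases at once. *)
Lemma powR_block_line_le A (p : R) x v (t : R) : 1 < p <= 2 ->
  block_l2 A (t *: v + x) `^ p - block_l2 A x `^ p -
    t * (p * block_l2 A x `^ (p - 2) * \sum_(i in A) x 0 i * v 0 i) <=
  `|t| * (p / 2 * block_l2 A x `^ (p - 2) * block_l2 A v ^+ 2 * `|t| +
    block_l2 A v `^ p * `|t| `^ (p - 1)).
Proof.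
move=> /andP[p1 p2].
have a0 := block_l2_ge0 A x; have b0 := block_l2_ge0 A (t *: v + x).
have v0 := block_l2_ge0 A v.
have k1 : 0 <= p / 2 * block_l2 A x `^ (p - 2) * block_l2 A v ^+ 2 * `|t|.
  by rewrite !mulr_ge0 ?powR_ge0 ?sqr_ge0//; lra.
have k2 : 0 <= block_l2 A v `^ p * `|t| `^ (p - 1) by rewrite mulr_ge0 ?powR_ge0.
have [x0|xn0] := eqVneq (block_l2 A x) 0.
  have -> : block_l2 A (t *: v + x) = `|t| * block_l2 A v.
    rewrite -block_l2Z /block_l2; congr Num.sqrt; apply: eq_bigr => i iA.
    by rewrite !mxE (block_l2_eq0 x0 iA) addr0.
  rewrite x0 (@powR0 _ p); last by rewrite gt_eqF; lra.
  rewrite big1 => [|i iA]; last by rewrite (block_l2_eq0 x0 iA) mul0r.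
  rewrite mulr0 mulr0 !subr0 powRM//.
  apply: (@le_trans _ _ (`|t| * (block_l2 A v `^ p * `|t| `^ (p - 1)))).
    by rewrite mulrCA mulr_powRB1//; [rewrite mulrC|lra].
  by rewrite x0 in k1; apply: ler_wpM2l => //; rewrite lerDr.
have xp : 0 < block_l2 A x by rewrite lt_neqAle eq_sym xn0.
have := @powR_le_tangent _ (p / 2) (block_l2 A x ^+ 2) (block_l2 A (t *: v + x) ^+ 2).
rewrite exprn_gt0// sqr_ge0 => /(_ ltac:(apply/andP; split; lra) isT isT).
rewrite -(powR_mulrn _ a0) -(powR_mulrn _ b0) -!powRrM.
rewrite (_ : 2%:R * (p / 2) = p); last by field.
rewrite (_ : 2%:R * (p / 2 - 1) = p - 2); last by field.
rewrite !powR_mulrn// sqr_block_l2_line -[t ^+ 2]real_normK ?num_real//.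
set Z := block_l2 A x `^ (p - 2) in k1 *; set X := \sum_(i in A) _.
have := mulr_ge0 (normr_ge0 t) k2; lra.
Qed.

End DgfGradient.

Section BregmanDivergence.
Context {R : realType} {d : nat}.
Implicit Types (A : {set 'I_d}) (P : {set {set 'I_d}}) (x y z u v : 'rV[R]_d).

(** On each block: the tangent of the power $p$, then Cauchy-Schwarz. *)
Lemma sum_powR_grad_le P (p : R) x z : finset.partition P [set: 'I_d]%SET ->
  1 < p <= 2 -> dotp (sum_powR_grad P p x) (z - x) <= sum_powR P p z - sum_powR P p x.
Proof.
move=> Pp p12; rewrite sum_powR_grad_dotp// /sum_powR -sumrB.
by apply: ler_sum => A _; exact: powR_block_grad_le.
Qed.

Lemma grad_sum_powR P (p : R) (kappa : R) x : finset.partition P [set: 'I_d]%SET ->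
  1 < p <= 2 -> 0 <= kappa ->
  grad (fun y => kappa * sum_powR P p y) x = kappa *: sum_powR_grad P p x.
Proof.
move=> Pp p12 k0; apply/rowP => i; rewrite [LHS]mxE [RHS]mxE.
set e : 'rV[R]_d := delta_mx 0 i.
have -> : sum_powR_grad P p x 0 i = dotp (sum_powR_grad P p x) e.
  rewrite /dotp (bigD1 i)//= [e _ _]mxE !eqxx mulr1 big1 ?addr0// => j ji.
  by rewrite [e _ _]mxE (negbTE ji) andbF mulr0.
pose c1 := \sum_(A in P) (p / 2 * block_l2 A x `^ (p - 2) * block_l2 A e ^+ 2).
pose c2 := \sum_(A in P) block_l2 A e `^ p.
apply: (@derive_squeeze _ _ _ _ _ _ (fun s => kappa * (c1 * s + c2 * s `^ (p - 1)))).
  rewrite -[X in _ --> X](_ : kappa * (c1 * 0 + c2 * 0) = 0); last by ring.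
  apply: cvgMl_tmp; apply: cvgD; apply: cvgMl_tmp.
    exact/cvg_at_right_filter/cvg_id.
  by apply: powR_cvg0; move: p12 => /andP[]; lra.
move=> t; have := sum_powR_grad_le x (t *: e + x) Pp p12; rewrite addrK.
have -> : dotp (sum_powR_grad P p x) (t *: e) = t * dotp (sum_powR_grad P p x) e.
  by rewrite /dotp mulr_sumr; apply: eq_bigr => j _; rewrite [(t *: e) 0 j]mxE mulrCA.
rewrite -mulrBr [t * (kappa * _)]mulrCA -mulrBr => h; apply/andP; split.
  by rewrite mulr_ge0// subr_ge0.
rewrite [leRHS]mulrCA; apply: ler_wpM2l => //.
rewrite sum_powR_grad_dotp// /sum_powR mulr_sumr -!sumrB.
rewrite /c1 /c2 !mulr_suml -big_split/= mulr_sumr.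
by apply: ler_sum => A _; exact: powR_block_line_le.
Qed.

Definition dgf_scale P (rho : R) : R :=
  rho ^+ 2 * ((block_gamma #|P| * block_exponent #|P|)^-1 *
  (rho^-1) `^ block_exponent #|P|).

Lemma block_dgf_scaledE P (rho : R) : 0 < rho ->
  block_dgf_scaled P rho =
  (fun x => dgf_scale P rho * sum_powR P (block_exponent #|P|) x).
Proof.
move=> rho0; apply/funext => x; rewrite /block_dgf_scaled /block_dgf /dgf_scale /sum_powR.
have iv0 : 0 <= rho^-1 by rewrite invr_ge0 ltW.
under eq_bigr => A _ do rewrite block_l2Z powRM ?block_l2_ge0// ger0_norm//.
by rewrite -mulr_sumr !mulrA.
Qed.

Lemma dgf_scale_ge0 P (rho : R) : (0 < #|P|)%N -> 0 <= dgf_scale P rho.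
Proof.
move=> P0; have /andP[p1 _] := @block_exponent_bounds R _ P0.
rewrite /dgf_scale mulr_ge0 ?sqr_ge0// mulr_ge0 ?powR_ge0// invr_ge0.
by rewrite mulr_ge0 ?(ltW (block_gamma_gt0 P0))//; lra.
Qed.

Lemma bregman_ge0 P (rho : R) x z : finset.partition P [set: 'I_d]%SET ->
  (0 < #|P|)%N -> 0 < rho -> 0 <= bregman (block_dgf_scaled P rho) z x.
Proof.
move=> Pp P0 rho0; have p12 := @block_exponent_bounds R _ P0.
have k0 := dgf_scale_ge0 rho P0.
rewrite /bregman block_dgf_scaledE// grad_sum_powR//.
have -> : forall k u, dotp (k *: sum_powR_grad P (block_exponent #|P|) x) u =
    k * dotp (sum_powR_grad P (block_exponent #|P|) x) u.
  by move=> k u; rewrite /dotp mulr_sumr; apply: eq_bigr => j _; rewrite mxE mulrA.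
rewrite -!mulrBr mulr_ge0// subr_ge0.
exact: sum_powR_grad_le.
Qed.

(** Yields continuity on the nonnegative half-line including 0, where powers are
    not continuous from the left. *)
Lemma powR_lipschitz (p M a b : R) : 1 < p -> 0 <= a -> 0 <= b ->
  a <= M -> b <= M -> `|a `^ p - b `^ p| <= p * M `^ (p - 1) * `|a - b|.
Proof.
move=> p1.
wlog ba : a b / b <= a => [hw a0 b0 aM bM|a0 b0 aM _].
  have [/hw|/ltW/hw] := leP b a; first exact.
  by rewrite distrC [`|b - a|]distrC; apply.
have p0 : 0 < p by lra.
rewrite !ger0_norm ?subr_ge0//; last first.
  by apply: ge0_ler_powR; rewrite ?nnegrE//; lra.
have [a_eq0|an0] := eqVneq a 0.
  have -> : b = a by lra.
  by rewrite !subrr mulr0.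
have ap : 0 < a by rewrite lt_neqAle eq_sym an0.
have tg := powR_ge_tangent (ltW p1) ap b0.
have aM' : a `^ (p - 1) <= M `^ (p - 1).
  by apply: ge0_ler_powR; rewrite ?nnegrE//; lra.
have ab : 0 <= a - b by lra.
have := ler_wpM2r ab (ler_wpM2l (ltW p0) aM').
have : p * a `^ (p - 1) * (b - a) = - (p * a `^ (p - 1) * (a - b)) by ring.
lra.
Qed.

Lemma continuous_sum (T : topologicalType) (I : Type) (r : seq I) (Q : pred I)
    (f : I -> T -> R) (t : T) :
  (forall i, Q i -> continuous_at t (f i)) ->
  continuous_at t (fun s => \sum_(i <- r | Q i) f i s).
Proof.
move=> fx; rewrite /continuous_at; elim: r => [|i r IH].
  by rewrite big_nil; under eq_fun do rewrite big_nil; exact: cvg_cst.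
rewrite big_cons; under eq_fun do rewrite big_cons.
by case: (boolP (Q i)) => // Qi; apply: cvgD => //; exact: fx.
Qed.

Lemma continuous_coord (i : 'I_d) : continuous (fun y : 'rV[R]_d => y 0 i).
Proof. exact: coord_continuous. Qed.

Lemma continuous_block_l2 A : continuous (block_l2 A : 'rV[R]_d -> R).
Proof.
move=> x.
have cS : continuous_at x (fun y : 'rV[R]_d => \sum_(i in A) y 0 i ^+ 2).
  apply: (@continuous_sum _ _ _ _ (fun i (y : 'rV[R]_d) => y 0 i ^+ 2)) => i _.
  by have c := @continuous_coord i x; exact: (cvgM c c).
exact: (continuous_cvg _ (@sqrt_continuous R _) cS).
Qed.

Lemma continuous_powR_comp (T : topologicalType) (u : T -> R) (p : R) (t : T) :
  1 < p -> (forall s, 0 <= u s) -> continuous_at t u ->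
  continuous_at t (fun s => u s `^ p).
Proof.
move=> p1 u0 cu; set a := u t.
have a0 : 0 <= a by exact: u0.
set L := p * (a + 1) `^ (p - 1).
have L0 : 0 < L by rewrite mulr_gt0 ?powR_gt0//; lra.
apply/cvgrPdist_le => e e0.
have e1 : 0 < Num.min 1 (e / L) by rewrite lt_min ltr01 divr_gt0.
move/cvgrPdist_le/(_ _ e1) : cu; apply: filterS => s.
rewrite -/a le_min => /andP[y1 ye].
have ya : u s <= a + 1 by move: y1; rewrite ler_norml => /andP[]; lra.
apply: le_trans (powR_lipschitz p1 a0 (u0 s) _ ya) _; first lra.
by rewrite -ler_pdivlMl// mulrC.
Qed.

Lemma continuous_sum_powR P (p : R) : 1 < p ->
  continuous (sum_powR P p : 'rV[R]_d -> R).
Proof.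
move=> p1 x.
apply: (@continuous_sum _ _ _ _ (fun A y => block_l2 A y `^ p)) => A _.
apply: continuous_powR_comp => // [y|]; first exact: block_l2_ge0.
exact: continuous_block_l2.
Qed.

Lemma continuous_block_dgf_scaled P (rho : R) : (0 < #|P|)%N -> 0 < rho ->
  continuous (block_dgf_scaled P rho : 'rV[R]_d -> R).
Proof.
move=> P0 rho0 x; have /andP[p1 _] := @block_exponent_bounds R _ P0.
have c := @continuous_sum_powR P _ p1 x.
rewrite block_dgf_scaledE//; exact: (cvgM (cvg_cst (dgf_scale P rho)) c).
Qed.

Lemma continuous_dotp v : continuous (dotp v : 'rV[R]_d -> R).
Proof.
move=> x; apply: (@continuous_sum _ _ _ _ (fun i y => v 0 i * y 0 i)) => i _.
by have c := @continuous_coord i x; exact: (cvgM (cvg_cst (v 0 i)) c).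
Qed.

Lemma continuous_bregman P (rho : R) x : (0 < #|P|)%N -> 0 < rho ->
  continuous ((bregman (block_dgf_scaled P rho))^~ x : 'rV[R]_d -> R).
Proof.
move=> P0 rho0 y; rewrite /bregman.
set h := block_dgf_scaled P rho; set g := grad h x.
have ch := @continuous_block_dgf_scaled P rho P0 rho0 y.
have cg := @continuous_dotp g y.
rewrite (_ : (fun z => _) = fun z => h z - h x - (dotp g z - dotp g x)).
  exact: (cvgB (cvgB ch (cvg_cst (h x))) (cvgB cg (cvg_cst (dotp g x)))).
apply/funext => z; congr (_ - _); rewrite /dotp -sumrB.
by apply: eq_bigr => i _; rewrite !mxE mulrBr.
Qed.

Lemma bregman_midpoint P (rho : R) x y z : (0 < #|P|)%N -> 0 < rho ->
  block_norm P y <= rho -> block_norm P z <= rho ->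
  bregman (block_dgf_scaled P rho) (midpoint y z) x + block_norm P (y - z) ^+ 2 / 64
  <= (bregman (block_dgf_scaled P rho) y x +
      bregman (block_dgf_scaled P rho) z x) / 2.
Proof.
move=> P0 rho0 yr zr; have := block_dgf_scaled_midpoint P0 rho0 yr zr.
rewrite /bregman; set g := grad _ _.
have -> : dotp g (midpoint y z - x) = (dotp g (y - x) + dotp g (z - x)) / 2.
  rewrite /dotp -big_split/= mulr_suml; apply: eq_bigr => i _.
  by rewrite !mxE; field.
lra.
Qed.

End BregmanDivergence.

(** * Follow the regularized leader *)

Section Ftrl.
Context {R : realType} {d : nat}.
Implicit Types (K : set 'rV[R]_d) (f Phi : 'rV[R]_d -> R) (x y z : 'rV[R]_d).
Implicit Types (h : seq ('rV[R]_d -> R)).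

Definition minimizes K f x := K x /\ forall y, K y -> f x <= f y.

Definition ftrl_objective Phi (eta : R) h x : R :=
  eta * (\sum_(g <- h) g x) + Phi x.

(** The imposed first point is a minimizer as well, since the regularizers used
    vanish at the starting point and are nonnegative. *)
Definition ftrl_point K x1 Phi eta h : 'rV[R]_d :=
  if h is [::] then x1 else xget x1 (minimizes K (ftrl_objective Phi eta h)).

Lemma ftrl_objective_rcons Phi eta h f x :
  ftrl_objective Phi eta (rcons h f) x = ftrl_objective Phi eta h x + eta * f x.
Proof. by rewrite /ftrl_objective -cats1 big_cat big_seq1/=; ring. Qed.

Variables (K : set 'rV[R]_d) (x1 : 'rV[R]_d) (P : {set {set 'I_d}}).
Variables (Phi : 'rV[R]_d -> R) (eta : R).
Hypothesis Pp : finset.partition P [set: 'I_d]%SET.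
Hypothesis Kcompact : compact K.
Hypothesis Kconvex : convex_set K.
Hypothesis Kx1 : K x1.
Hypothesis eta0 : 0 < eta.
Hypothesis Phi_cont : continuous Phi.
Hypothesis Phi_x1 : Phi x1 = 0.
Hypothesis Phi_ge0 : forall x, K x -> 0 <= Phi x.
Hypothesis Phi_midpoint : forall x y, K x -> K y ->
  Phi (midpoint x y) + block_norm P (x - y) ^+ 2 / 64 <= (Phi x + Phi y) / 2.

Lemma midpoint_in x y : K x -> K y -> K (midpoint x y).
Proof.
move=> Kx Ky; rewrite /midpoint scalerDr.
have {2}-> : 2^-1 = 1 - 2^-1 :> R by field.
by apply: convex_set_comb => //; apply/andP; split; lra.
Qed.

Lemma convex_function_midpoint f x y : convex_function K (f : 'rV[R]_d -> R^o) ->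
  K x -> K y -> f (midpoint x y) <= (f x + f y) / 2.
Proof.
move=> fc Kx Ky; rewrite /midpoint scalerDr.
have {2}-> : 2^-1 = 1 - 2^-1 :> R by field.
apply: le_trans (convex_function_comb fc Kx Ky _) _; last by lra.
by apply/andP; split; lra.
Qed.

Lemma ftrl_pointP h : (forall g, g \in h -> admissible_loss K g) ->
  minimizes K (ftrl_objective Phi eta h) (ftrl_point K x1 Phi eta h).
Proof.
case: h => [_|g0 h hK].
  split=> // y Ky; rewrite /ftrl_objective !big_nil mulr0 !add0r Phi_x1.
  exact: Phi_ge0.
set h' := g0 :: h in hK *.
rewrite /ftrl_point; apply: xgetPex.
have cont : {within K, continuous (ftrl_objective Phi eta h')}.
  apply: continuous_in_subspaceT => x /set_mem Kx.
  have cs : continuous_at x (fun y => \sum_(g <- h' | g \in h') g y).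
    apply: (@continuous_sum _ _ _ _ _ (fun g y => g y)) => g gh.
    have [_ gd _] := hK g gh.
    exact: (@differentiable_continuous _ _ R^o _ _ (gd x Kx)).
  rewrite (_ : ftrl_objective Phi eta h' =
    fun y => eta * (\sum_(g <- h' | g \in h') g y) + Phi y); last first.
    by apply/funext => y; rewrite /ftrl_objective big_seq.
  exact: (cvgD (cvgM (cvg_cst eta) cs) (@Phi_cont x)).
have [|c cK cmin] := EVT_min_rV _ Kcompact cont; first by exists x1.
exists c; split; first exact: set_mem.
by move=> y Ky; apply: cmin; exact: mem_set.
Qed.

(** The minimum is at most the value at the midpoint of $x$ and $y$. *)
Lemma ftrl_quadratic_growth h x y :
  (forall g, g \in h -> admissible_loss K g) ->
  minimizes K (ftrl_objective Phi eta h) x -> K y ->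
  ftrl_objective Phi eta h x + block_norm P (x - y) ^+ 2 / 32 <=
  ftrl_objective Phi eta h y.
Proof.
move=> hK [Kx xmin] Ky.
have := xmin _ (midpoint_in Kx Ky).
have := Phi_midpoint Kx Ky.
have : \sum_(g <- h) g (midpoint x y) <= (\sum_(g <- h) g x + \sum_(g <- h) g y) / 2.
  rewrite -big_split/= mulr_suml big_seq [leRHS]big_seq; apply: ler_sum => g gh.
  by have [gc _ _] := hK g gh; exact: convex_function_midpoint.
move=> /(ler_wpM2l (ltW eta0)); rewrite /ftrl_objective; lra.
Qed.

(** The least value of the objective serves as potential. The loss $f_t$ raises it
    by $eta f_t(x_t)$, less what is gained by moving the minimizer: at most the
    dual norm of a gradient times the distance, from which quadratic growth takes
    back a multiple of the squared distance. *)
Lemma ftrl_regret h (f0 : 'rV[R]_d -> R) (G : nat -> R) u :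
  (forall g, g \in h -> admissible_loss K g) ->
  (forall t x, (t < size h)%N -> K x ->
     block_dual_norm P (grad (nth f0 h t) x) ^+ 2 <= G t) ->
  K u ->
  \sum_(t < size h) nth f0 h t (ftrl_point K x1 Phi eta (take t h)) <=
  \sum_(t < size h) nth f0 h t u + Phi u / eta + 8 * eta * \sum_(t < size h) G t.
Proof.
move=> hK hG Ku.
pose x t := ftrl_point K x1 Phi eta (take t h).
have takeK t g : g \in take t h -> admissible_loss K g.
  by move=> /mem_take; exact: hK.
have xmin t := ftrl_pointP (takeK t).
have step t : (t <= size h)%N ->
    eta * (\sum_(s < t) nth f0 h s (x s)) <=
    ftrl_objective Phi eta (take t h) (x t) + 8 * eta ^+ 2 * \sum_(s < t) G s.
  elim: t => [_|t IH th].
    rewrite !big_ord0 !mulr0 addr0 take0 /ftrl_objective big_nil mulr0 add0r.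
    by rewrite /x take0 Phi_x1.
  have {}IH := IH (ltnW th).
  have [Kxt _] := xmin t; have [Kxt1 _] := xmin t.+1.
  rewrite -/(x t) in Kxt; rewrite -/(x t.+1) in Kxt1.
  have gr := ftrl_quadratic_growth (takeK t) (xmin t) Kxt1.
  rewrite -/(x t) in gr.
  have [fc fd _] : admissible_loss K (nth f0 h t) by apply: hK; exact: mem_nth.
  have lin := convex_grad_le fc (fd _ Kxt) Kxt Kxt1.
  have du := dotp_le_dual (grad (nth f0 h t) (x t)) (x t - x t.+1) Pp.
  have duN : dotp (grad (nth f0 h t) (x t)) (x t.+1 - x t) =
      - dotp (grad (nth f0 h t) (x t)) (x t - x t.+1).
    by rewrite /dotp -sumrN; apply: eq_bigr => i _; rewrite !mxE; ring.
  have Gt := hG t (x t) th Kxt.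
  rewrite !big_ord_recr/= (take_nth f0 th) ftrl_objective_rcons.
  move: gr du Gt lin; rewrite duN.
  set D := block_dual_norm _ _; set delta := block_norm _ _; set W := dotp _ _.
  move=> gr du Gt lin.
  have yg : eta * (D * delta) <= delta ^+ 2 / 32 + 8 * eta ^+ 2 * D ^+ 2.
      (* The squared distance paid for moving absorbs the gain. *)
  rewrite -subr_ge0 (_ : _ - _ = (delta - 16 * (eta * D)) ^+ 2 / 32); last by field.
    by rewrite divr_ge0// sqr_ge0.
  have G8 : 8 * eta ^+ 2 * D ^+ 2 <= 8 * eta ^+ 2 * G t.
    by rewrite ler_wpM2l// mulr_ge0// sqr_ge0.
  have lin' : eta * nth f0 h t (x t) <= eta * nth f0 h t (x t.+1) + eta * (D * delta).
    by rewrite -mulrDr ler_wpM2l ?(ltW eta0)//; lra.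
  move: IH gr lin' yg G8; rewrite !mulrDr; lra.
have := step _ (leqnn _); rewrite take_size => fin.
have [_ /(_ u Ku)] := ftrl_pointP hK.
rewrite [leRHS]/ftrl_objective -/(x (size h)) => ub.
have xsz : ftrl_point K x1 Phi eta h = x (size h) by rewrite /x take_size.
rewrite xsz in ub.
rewrite (big_nth f0) big_mkord in ub.
rewrite -(ler_pM2l eta0).
have -> : eta * (\sum_(t < size h) nth f0 h t u + Phi u / eta +
    8 * eta * \sum_(t < size h) G t) = eta * (\sum_(t < size h) nth f0 h t u) +
    Phi u + 8 * eta ^+ 2 * \sum_(t < size h) G t by field; rewrite gt_eqF.
exact: le_trans fin (lerD ub (lexx _)).
Qed.

End Ftrl.

(** * Gradient bounds for different numbers of blocks *)

Section GradientBounds.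
Context {R : realType} {d : nat}.
Implicit Types (P : {set {set 'I_d}}) (K : set 'rV[R]_d) (g : 'rV[R]_d).
Implicit Types (f : 'rV[R]_d -> R) (s : {perm 'I_d}).

Definition random_partition n s := permute_blocks s (@interval_partition d n).

Lemma random_partition_equal n s : (0 < n <= d)%N ->
  random_partition n s \in equal_partitions n.
Proof. by move=> nd; exact/permute_blocks_equal/interval_partition_equal. Qed.

Lemma block_dual_norm_sqr_le P g (c : R) : 0 <= c ->
  (forall A, A \in P -> block_l2 A g ^+ 2 <= c) -> block_dual_norm P g ^+ 2 <= c.
Proof.
move=> c0 gc; rewrite -(sqr_sqrtr c0) ler_sqr ?nnegrE ?sqrtr_ge0//; last first.
  exact: block_dual_norm_ge0.
apply: bigmax_le => [|A AP]; first exact: sqrtr_ge0.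
by rewrite -ler_sqr ?nnegrE ?sqrtr_ge0 ?block_l2_ge0// [leRHS]sqr_sqrtr// gc.
Qed.

(** Also true beyond the last block, where the sum is empty; the successors of a
    block can then be used without checking that they exist. *)
Lemma sum_interval_block_le n s g (w : nat) : (0 < n)%N ->
  \sum_(i in @interval_block d n w) g 0 (s i) ^+ 2 <=
  block_dual_norm (random_partition n s) g ^+ 2.
Proof.
move=> n0; have [wn|nw] := ltnP w n; last first.
  rewrite big1 ?sqr_ge0// => i; rewrite inE => /eqP wi.
  by have := interval_index_lt i n0; rewrite wi ltnNge nw.
have -> : \sum_(i in @interval_block d n w) g 0 (s i) ^+ 2 =
    block_l2 (s @: interval_block n w)%SET g ^+ 2.
  by rewrite sqr_block_l2 big_imset//= => i j _ _ /perm_inj.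
rewrite ler_sqr ?nnegrE ?block_l2_ge0 ?block_dual_norm_ge0//.
apply: block_l2_le_dual; apply: imset_f; apply/imsetP.
by exists (Ordinal wn).
Qed.

(** Rounding $i m / d$ loses less than one unit, that is less than $n / m < 2$ units
    on the scale of $i n / d$. *)
Lemma interval_index_range n m (i : 'I_d) : (0 < m)%N -> (n < m.*2)%N ->
  (interval_index m i * n %/ m <= interval_index n i
    <= (interval_index m i * n %/ m).+2)%N.
Proof.
move=> m0 nm; have id := ltn_ord i; have d0 : (0 < d)%N by exact: leq_trans id.
rewrite /interval_index; set j := (i * m %/ d)%N.
have j1 : (j * d <= i * m)%N by exact: leq_trunc_div.
have j2 : (i * m < j.+1 * d)%N by exact: ltn_ceil.
set q := (j * n %/ m)%N.
have q1 : (q * m <= j * n)%N by exact: leq_trunc_div.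
have q2 : (j * n < q.+1 * m)%N by exact: ltn_ceil.
apply/andP; split.
  rewrite leq_divRL// -(leq_pmul2r m0).
  have h1 : (q * m * d <= j * n * d)%N by rewrite leq_mul2r q1 orbT.
  have h2 : (j * d * n <= i * m * n)%N by rewrite leq_mul2r j1 orbT.
  lia.
rewrite -ltnS ltn_divLR// -(ltn_pmul2r m0).
have [->|n0] := posnP n; first by rewrite muln0 mul0n !muln_gt0 d0 m0.
have h2 : (i * m * n < j.+1 * d * n)%N by rewrite ltn_pmul2r.
have h1 : (j * n * d < q.+1 * m * d)%N by rewrite ltn_pmul2r.
have h3 : (n * d < m.*2 * d)%N by rewrite ltn_pmul2r.
lia.
Qed.

Lemma dual_norm_refine_le n m s g : (0 < n)%N -> (0 < m)%N -> (n < m.*2)%N ->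
  block_dual_norm (random_partition m s) g ^+ 2 <=
  3 * block_dual_norm (random_partition n s) g ^+ 2.
Proof.
move=> n0 m0 nm; apply: block_dual_norm_sqr_le.
  by rewrite mulr_ge0// sqr_ge0.
move=> _ /imsetP[_ /imsetP[j _ ->] ->].
set v := (j * n %/ m)%N.
have := sum_interval_block_le s g v n0.
have := sum_interval_block_le s g v.+1 n0.
have := sum_interval_block_le s g v.+2 n0.
rewrite sqr_block_l2 big_imset; last by move=> ? ? _ _ /perm_inj.
suff : \sum_(i in interval_block m j) g 0 (s i) ^+ 2 <=
    \sum_(i in interval_block n v) g 0 (s i) ^+ 2 +
    \sum_(i in interval_block n v.+1) g 0 (s i) ^+ 2 +
    \sum_(i in interval_block n v.+2) g 0 (s i) ^+ 2 by rewrite /=; lra.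
rewrite big_mkcond [X in _ <= X + _ + _]big_mkcond [X in _ <= _ + X + _]big_mkcond.
rewrite [X in _ <= _ + _ + X]big_mkcond -!big_split/=; apply: ler_sum => i _.
have x0 := sqr_ge0 (g 0 (s i)).
rewrite !inE; case: eqP => [ij|_]; last by do 3! case: ifP => _; lra.
have := interval_index_range i m0 nm; rewrite ij -/v => /andP[v1 v2].
move: v1; rewrite leq_eqVlt => /orP[/eqP <-|v1].
  by rewrite eqxx; do 2! case: ifP => _; lra.
move: v1; rewrite leq_eqVlt => /orP[/eqP <-|v1].
  by rewrite eqxx; do 2! case: ifP => _; lra.
have -> : interval_index n i = v.+2 by apply/eqP; rewrite eqn_leq v2.
by rewrite eqxx; do 2! case: ifP => _; lra.
Qed.

Section OneLoss.
Variables (K : set 'rV[R]_d) (x1 : 'rV[R]_d) (f : 'rV[R]_d -> R).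
Hypothesis Kx1 : K x1.
Hypothesis fb : has_ubound [set l2norm (grad f x) | x in K].

Lemma dual_grad_le_sup P x : K x ->
  block_dual_norm P (grad f x) ^+ 2 <= sup_dual_grad_sq P K f.
Proof.
move=> Kx; apply: ub_le_sup; last by exists x.
have [M MK] := fb; exists (M ^+ 2) => _ [y Ky <-].
have yM : l2norm (grad f y) <= M by apply: MK; exists y.
have h := block_dual_le_l2norm P (grad f y).
have y0 := block_dual_norm_ge0 P (grad f y).
have hM := le_trans h yM.
by rewrite ler_sqr ?nnegrE//; exact: le_trans hM.
Qed.

Lemma sup_dual_le P (c : R) :
  (forall x, K x -> block_dual_norm P (grad f x) ^+ 2 <= c) ->
  sup_dual_grad_sq P K f <= c.
Proof.
move=> h; apply: ge_sup; first by exists (block_dual_norm P (grad f x1) ^+ 2), x1.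
by move=> _ [x Kx <-]; exact: h.
Qed.

Lemma sup_dual_ge0 P : 0 <= sup_dual_grad_sq P K f.
Proof. by apply: le_trans (dual_grad_le_sup P Kx1); exact: sqr_ge0. Qed.

Lemma sup_dual_refine_le n m s : (0 < n)%N -> (0 < m)%N -> (n < m.*2)%N ->
  sup_dual_grad_sq (random_partition m s) K f <=
  3 * sup_dual_grad_sq (random_partition n s) K f.
Proof.
move=> n0 m0 nm; apply: sup_dual_le => x Kx.
apply: le_trans (dual_norm_refine_le s _ n0 m0 nm) _.
by rewrite ler_pM2l// dual_grad_le_sup.
Qed.

Lemma sup_dual_le_l2norm P :
  sup_dual_grad_sq P K f <= sup [set l2norm (grad f x) | x in K] ^+ 2.
Proof.
have ub x : K x -> l2norm (grad f x) <= sup [set l2norm (grad f x) | x in K].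
  by move=> Kx; apply: ub_le_sup => //; exists x.
apply: sup_dual_le => x Kx.
have h := block_dual_le_l2norm P (grad f x).
have y0 := block_dual_norm_ge0 P (grad f x).
have hub := le_trans h (ub _ Kx).
by rewrite ler_sqr ?nnegrE//; exact: le_trans hub.
Qed.

Lemma sup_l2norm_le_dual P : finset.partition P [set: 'I_d]%SET ->
  sup [set l2norm (grad f x) | x in K] ^+ 2 <= #|P|%:R * sup_dual_grad_sq P K f.
Proof.
move=> Pp; have S0 := sup_dual_ge0 P.
have c0 : 0 <= #|P|%:R * sup_dual_grad_sq P K f by rewrite mulr_ge0.
have s0 : 0 <= sup [set l2norm (grad f x) | x in K].
  apply: (@le_trans _ _ (l2norm (grad f x1))); first exact: l2norm_ge0.
    by apply: ub_le_sup => //; exists x1.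
rewrite -(sqr_sqrtr c0) ler_sqr ?nnegrE ?sqrtr_ge0//.
apply: ge_sup; first by exists (l2norm (grad f x1)), x1.
move=> _ [x Kx <-]; rewrite -ler_sqr ?nnegrE ?sqrtr_ge0 ?l2norm_ge0// [leRHS]sqr_sqrtr//.
apply: le_trans (sqr_l2norm_le_dual _ Pp) _.
by rewrite ler_wpM2l// dual_grad_le_sup.
Qed.

End OneLoss.

Lemma mean_partition_le n (F : {set {set 'I_d}} -> R) c : (0 < n <= d)%N ->
  (forall P, P \in equal_partitions n -> F P <= c) -> mean_partition n F <= c.
Proof.
move=> nd Fc; have E0 := @card_equal_partitions_gt0 d R n nd.
rewrite /mean_partition ler_pdivrMr//.
apply: le_trans (ler_sum _ (fun P Pn => Fc P Pn)) _.
by rewrite sumr_const mulr_natr.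
Qed.

Lemma mean_partition_ge n (F : {set {set 'I_d}} -> R) c : (0 < n <= d)%N ->
  (forall P, P \in equal_partitions n -> c <= F P) -> c <= mean_partition n F.
Proof.
move=> nd Fc; have E0 := @card_equal_partitions_gt0 d R n nd.
rewrite /mean_partition ler_pdivlMr//.
apply: le_trans (ler_sum _ (fun P Pn => Fc P Pn)).
by rewrite sumr_const mulr_natr.
Qed.

Section Losses.
Variables (K : set 'rV[R]_d) (x1 : 'rV[R]_d) (T : nat).
Variables (f : T.-tuple ('rV[R]_d -> R)).
Hypothesis Kx1 : K x1.
Hypothesis fb : forall t, has_ubound [set l2norm (grad (tnth f t) x) | x in K].

Lemma block_grad_bound_ge0 n : 0 <= block_grad_bound n K f.
Proof. exact: bigmax_ge_id. Qed.

Lemma mean_sup_dual_le n t : (0 < n <= d)%N ->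
  mean_partition n (fun P => sup_dual_grad_sq P K (tnth f t)) <=
  block_grad_bound n K f ^+ 2.
Proof.
move=> nd; have m0 : 0 <= mean_partition n (fun P => sup_dual_grad_sq P K (tnth f t)).
  by apply: mean_partition_ge => // P _; exact: (sup_dual_ge0 Kx1).
rewrite -[leLHS]sqr_sqrtr// ler_sqr ?nnegrE ?sqrtr_ge0 ?block_grad_bound_ge0//.
exact: (le_bigmax _ (fun t => Num.sqrt (mean_partition n
  (fun P => sup_dual_grad_sq P K (tnth f t))))).
Qed.

Lemma block_grad_bound_le n (c : R) : 0 <= c ->
  (forall t, mean_partition n (fun P => sup_dual_grad_sq P K (tnth f t)) <= c ^+ 2) ->
  block_grad_bound n K f <= c.
Proof.
move=> c0 h; apply: bigmax_le => // t _.
by rewrite -(ger0_norm c0) -sqrtr_sqr ler_wsqrtr.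
Qed.

(** A factor 3 on squared norms, hence at most 2 on norms. *)
Lemma block_grad_bound_refine_le n m : (0 < n <= d)%N -> (0 < m <= d)%N ->
  (n < m.*2)%N -> block_grad_bound m K f <= 2 * block_grad_bound n K f.
Proof.
move=> nd md nm; have /andP[m0 _] := md; have /andP[n0 _] := nd.
apply: block_grad_bound_le; first by rewrite mulr_ge0// block_grad_bound_ge0.
move=> t; have S0 : 0 < #|{perm 'I_d}|%:R :> R.
  by rewrite ltr0n; apply/card_gt0P; exists 1%g.
apply: (@le_trans _ _ (3 * mean_partition n (fun P => sup_dual_grad_sq P K (tnth f t)))).
  rewrite !mean_partitionE// mulrA ler_pM2r ?invr_gt0// mulr_sumr.
  by apply: ler_sum => s _; exact: (sup_dual_refine_le Kx1).
have := mean_sup_dual_le t nd; have := sqr_ge0 (block_grad_bound n K f).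
rewrite exprMn; lra.
Qed.

(** Convertible to the field [l2_grad_bound] of [input_of K x1 f]. *)
Definition l2_bound : R := \big[Num.max/0]_(t < T)
  sup [set l2norm (grad (tnth f t) x) | x in K].

Lemma l2_bound_ge0 : 0 <= l2_bound. Proof. exact: bigmax_ge_id. Qed.

Lemma block_grad_bound_le_l2 n : (0 < n <= d)%N ->
  block_grad_bound n K f <= l2_bound.
Proof.
move=> nd; apply: block_grad_bound_le; first exact: l2_bound_ge0.
move=> t; apply: mean_partition_le => // P _.
apply: le_trans (sup_dual_le_l2norm Kx1 (fb t) P) _.
rewrite ler_sqr ?nnegrE ?l2_bound_ge0//.
  exact: (le_bigmax _ (fun t => sup [set l2norm (grad (tnth f t) x) | x in K])).
apply: (@le_trans _ _ (l2norm (grad (tnth f t) x1))); first exact: l2norm_ge0.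
by apply: ub_le_sup => //; exists x1.
Qed.

Lemma l2_bound_le_block n : (0 < n <= d)%N ->
  l2_bound ^+ 2 <= n%:R * block_grad_bound n K f ^+ 2.
Proof.
move=> nd; have c0 : 0 <= n%:R * block_grad_bound n K f ^+ 2.
  by rewrite mulr_ge0// sqr_ge0.
rewrite -(sqr_sqrtr c0) ler_sqr ?nnegrE ?sqrtr_ge0 ?l2_bound_ge0//.
apply: bigmax_le => [|t _]; first exact: sqrtr_ge0.
have s0 : 0 <= sup [set l2norm (grad (tnth f t) x) | x in K].
  apply: (@le_trans _ _ (l2norm (grad (tnth f t) x1))); first exact: l2norm_ge0.
  by apply: ub_le_sup => //; exists x1.
rewrite -ler_sqr ?nnegrE ?sqrtr_ge0// sqr_sqrtr//.
apply: le_trans (_ : _ <= n%:R * mean_partition n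
  (fun P => sup_dual_grad_sq P K (tnth f t))) _; last first.
  by rewrite ler_wpM2l// mean_sup_dual_le.
have n0 : 0 < n%:R :> R by rewrite ltr0n; case/andP: nd.
rewrite -ler_pdivrMl//; apply: mean_partition_ge => // P /equal_partitionsP[Pp Pn _].
by rewrite ler_pdivrMl// -Pn; exact: (sup_l2norm_le_dual Kx1).
Qed.

End Losses.

End GradientBounds.

(** * Diameter of the body and range of the losses *)

Section Diameter.
Context {R : realType} {d : nat}.
Implicit Types (P : {set {set 'I_d}}) (f : 'rV[R]_d -> R).

Lemma compact_has_ubound (K : set 'rV[R]_d) (F : 'rV[R]_d -> R) :
  compact K -> K !=set0 -> continuous F -> has_ubound [set F x | x in K].
Proof.
move=> Kc K0 cF.
have [|c _ cmax] := EVT_max_rV K0 Kc (f := F); first exact: continuous_subspaceT.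
by exists (F c) => _ [x Kx <-]; apply: cmax; exact: mem_set.
Qed.

Lemma continuous_block_norm P : continuous (block_norm P : 'rV[R]_d -> R).
Proof.
move=> x; apply: (@continuous_sum _ _ _ _ _ (fun A y => block_l2 A y)) => A _.
exact: continuous_block_l2.
Qed.

Variables (K : set 'rV[R]_d) (x1 : 'rV[R]_d) (n : nat).
Hypothesis Kclosed : closed K.
Hypothesis Kbounded : bounded_set K.
Hypothesis Kconvex : convex_set K.
Hypothesis Kn0 : K <> [set 0].
Hypothesis Kx1 : K x1.
Hypothesis nd : (0 < n <= d)%N.

Local Notation rho := (block_radius n K).

Definition mirror P : 'rV[R]_d -> R := (bregman (block_dgf_scaled P rho))^~ x1.

Definition sup_mirror P : R := sup [set mirror P z | z in K].

Lemma body_compact : compact K.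
Proof. exact: bounded_closed_compact. Qed.

Lemma block_norm_le_radius P x : P \in equal_partitions n -> K x ->
  block_norm P x <= rho.
Proof.
move=> Pn Kx; apply: (@le_trans _ _ (sup [set block_norm P x | x in K])).
  apply: ub_le_sup; last by exists x.
  apply: compact_has_ubound; [exact: body_compact|by exists x1|].
  exact: continuous_block_norm.
exact: (le_bigmax_cond _ (fun P => sup [set block_norm P x | x in K]) Pn).
Qed.

Lemma block_radius_gt0 : 0 < rho.
Proof.
have [x Kx x0] : exists2 x, K x & x != 0.
  apply: contrapT => h; apply: Kn0; apply/seteqP; split => [x Kx|_ ->] /=.
    by apply: contrapT => /eqP x0; apply: h; exists x.
  have [<-//|/eqP x10] := pselect (x1 = 0).
  by exfalso; apply: h; exists x1.
have Pn := interval_partition_equal nd.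
apply: lt_le_trans (block_norm_le_radius Pn Kx).
by apply: block_norm_gt0 => //; case/equal_partitionsP: Pn.
Qed.

Section OnePartition.
Variable P : {set {set 'I_d}}.
Hypothesis Pn : P \in equal_partitions n.

Lemma equal_partition_partition : finset.partition P [set: 'I_d]%SET.
Proof. by have /equal_partitionsP[] := Pn. Qed.

Lemma equal_partition_card_gt0 : (0 < #|P|)%N.
Proof. by have /equal_partitionsP[_ ->] := Pn; case/andP: nd. Qed.

Let Pp := equal_partition_partition.
Let P0 := equal_partition_card_gt0.
Let rho0 := block_radius_gt0.

Lemma mirror_continuous : continuous (mirror P).
Proof. exact: continuous_bregman. Qed.

Lemma mirror_start : mirror P x1 = 0.
Proof.
rewrite /mirror /bregman subrr sub0r /dotp big1 ?oppr0// => i _.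
by rewrite subrr [X in _ * X]mxE mulr0.
Qed.

Lemma mirror_ge0 z : 0 <= mirror P z.
Proof. exact: bregman_ge0. Qed.

Lemma mirror_midpoint y z : K y -> K z ->
  mirror P (midpoint y z) + block_norm P (y - z) ^+ 2 / 64 <=
  (mirror P y + mirror P z) / 2.
Proof. by move=> Ky Kz; apply: bregman_midpoint => //; exact: block_norm_le_radius. Qed.

Lemma mirror_le_sup z : K z -> mirror P z <= sup_mirror P.
Proof.
move=> Kz; apply: ub_le_sup; last by exists z.
by apply: compact_has_ubound; [exact: body_compact|by exists x1|exact: mirror_continuous].
Qed.

Lemma sup_mirror_ge0 : 0 <= sup_mirror P.
Proof. by apply: le_trans (mirror_le_sup Kx1); exact: mirror_ge0. Qed.

(** [x1] minimizes the divergence, which has midpoint convexity. *)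
Lemma sqr_block_dist_start z : K z -> block_norm P (z - x1) ^+ 2 <= 32 * sup_mirror P.
Proof.
move=> Kz; have := mirror_midpoint Kz Kx1; rewrite mirror_start.
have := mirror_ge0 (midpoint z x1); have := mirror_le_sup Kz; lra.
Qed.

Lemma block_dist_le x z : K x -> K z ->
  block_norm P (x - z) <= Num.sqrt (128 * sup_mirror P).
Proof.
move=> Kx Kz; have S0 := sup_mirror_ge0.
have -> : x - z = (x - x1) + - (z - x1) by rewrite opprB addrA subrK.
apply: le_trans (block_normD _ _ _) _; rewrite block_normN.
have b y : K y -> block_norm P (y - x1) <= Num.sqrt (32 * sup_mirror P).
  move=> Ky; rewrite -[leLHS](ger0_norm (block_norm_ge0 _ _)) -sqrtr_sqr.
  by rewrite ler_wsqrtr// sqr_block_dist_start.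
have -> : 128 * sup_mirror P = 2 ^+ 2 * (32 * sup_mirror P) by ring.
rewrite sqrtrM ?sqr_ge0// sqrtr_sqr ger0_norm//.
by have := b x Kx; have := b z Kz; lra.
Qed.

End OnePartition.

Lemma sqr_block_diameter :
  block_diameter n K x1 ^+ 2 = mean_partition n sup_mirror.
Proof.
rewrite sqr_sqrtr//; apply: mean_partition_ge => // P Pn.
exact: sup_mirror_ge0.
Qed.

Lemma block_diameter_ge0 : 0 <= block_diameter n K x1.
Proof. exact: sqrtr_ge0. Qed.

(** A convex loss varies by at most the dual norm of a gradient times a distance;
    with the two suprema of the same partition this is averaged by
    Cauchy-Schwarz. *)
Lemma loss_range_le T (f : T.-tuple ('rV[R]_d -> R)) t x z :
  (forall t, admissible_loss K (tnth f t)) -> K x -> K z ->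
  tnth f t x - tnth f t z <= 12 * (block_diameter n K x1 * block_grad_bound n K f).
Proof.
move=> fK Kx Kz; have [fc fd fb] := fK t.
have fbs t' : has_ubound [set l2norm (grad (tnth f t') x) | x in K].
  by have [] := fK t'.
have D0 := block_diameter_ge0; have G0 := block_grad_bound_ge0 K f n.
set v := _ - _.
have [v0|vp] := leP v 0; first by apply: le_trans v0 _; rewrite mulr_ge0// mulr_ge0.
pose Sg P := sup_dual_grad_sq P K (tnth f t).
have Sg0 P : 0 <= Sg P by exact: (sup_dual_ge0 Kx1 fb).
have vle P : P \in equal_partitions n ->
    v <= Num.sqrt 128 * (Num.sqrt (Sg P) * Num.sqrt (sup_mirror P)).
  move=> Pn; have := convex_grad_le fc (fd _ Kx) Kx Kz.
  have := dotp_le_dual (grad (tnth f t) x) (x - z) (equal_partition_partition Pn).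
  have -> : dotp (grad (tnth f t) x) (z - x) = - dotp (grad (tnth f t) x) (x - z).
    by rewrite /dotp -sumrN; apply: eq_bigr => i _; rewrite !mxE; ring.
  have := block_dist_le Pn Kx Kz; rewrite sqrtrM// => h1 h2 h3.
  apply: (@le_trans _ _ (block_dual_norm P (grad (tnth f t) x) * block_norm P (x - z))).
    by rewrite /v; lra.
  rewrite mulrCA; apply: ler_pM => //; [exact: block_dual_norm_ge0|exact: block_norm_ge0|].
  rewrite -[leLHS](ger0_norm (block_dual_norm_ge0 _ _)) -sqrtr_sqr.
  by rewrite ler_wsqrtr// (dual_grad_le_sup fb).
have E0 := @card_equal_partitions_gt0 d R n nd; set E : R := #|_|%:R in E0.
have h1 : E * v <= Num.sqrt 128 *
    \sum_(P in equal_partitions n) Num.sqrt (Sg P) * Num.sqrt (sup_mirror P).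
  rewrite mulr_sumr; apply: le_trans (ler_sum _ (fun P Pn => vle P Pn)).
  by rewrite sumr_const mulr_natl.
have h2 := sum_cauchy_schwarz (mem (equal_partitions n))
  (fun P => Num.sqrt (Sg P)) (fun P => Num.sqrt (sup_mirror P)).
have s1 : \sum_(P in equal_partitions n) Num.sqrt (Sg P) ^+ 2 =
    E * mean_partition n Sg.
  rewrite /mean_partition mulrC divfK ?gt_eqF//.
  by apply: eq_bigr => P _; rewrite sqr_sqrtr.
have s2 : \sum_(P in equal_partitions n) Num.sqrt (sup_mirror P) ^+ 2 =
    E * mean_partition n sup_mirror.
  rewrite /mean_partition mulrC divfK ?gt_eqF//.
  by apply: eq_bigr => P Pn; rewrite sqr_sqrtr// sup_mirror_ge0.
rewrite s1 s2 in h2.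
have mSg : mean_partition n Sg <= block_grad_bound n K f ^+ 2.
  exact: (mean_sup_dual_le Kx1 fbs t nd).
have Ev : (E * v) ^+ 2 <= 128 * ((E * mean_partition n Sg) *
    (E * mean_partition n sup_mirror)).
  have Ev0 : 0 <= E * v by rewrite mulr_ge0// ltW.
  apply: (@le_trans _ _ ((Num.sqrt 128 * \sum_(P in equal_partitions n)
      Num.sqrt (Sg P) * Num.sqrt (sup_mirror P)) ^+ 2)).
    by rewrite ler_sqr ?nnegrE//; exact: le_trans h1.
  by rewrite exprMn sqr_sqrtr// ler_wpM2l.
have v2 : v ^+ 2 <= 128 * (mean_partition n Sg * mean_partition n sup_mirror).
  rewrite -(ler_pM2l (exprn_gt0 2 E0)) -exprMn.
  by apply: le_trans Ev _; rewrite le_eqVlt; apply/orP; left; apply/eqP; ring.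
have DG0 : 0 <= block_diameter n K x1 * block_grad_bound n K f by rewrite mulr_ge0.
rewrite -ler_sqr ?nnegrE ?mulr_ge0//; last exact: ltW.
apply: le_trans v2 _; rewrite -sqr_block_diameter exprMn exprMn.
apply: (@le_trans _ _ (128 * (block_grad_bound n K f ^+ 2 * block_diameter n K x1 ^+ 2))).
  by rewrite ler_pM2l// ler_wpM2r// sqr_ge0.
(* The constant 12 comes from 128 <= 12 ^ 2. *)
rewrite mulrC [_ * block_diameter n K x1 ^+ 2]mulrC.
rewrite -subr_ge0.
have := mulr_ge0 (sqr_ge0 (block_diameter n K x1)) (sqr_ge0 (block_grad_bound n K f)).
lra.
Qed.

End Diameter.

(** * The portfolio *)

Section Algorithm.
Context {R : realType} {d : nat}.
Variable I : oco_input (R := R) d.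

Definition grid_size : nat := (trunc_log 2 d).+1.

Definition expert : finType := ('I_grid_size * 'I_grid_size)%type.

(** The diameters depend on the body and on the starting point only, so the learner
    may keep the best number of blocks of each dyadic range. *)
Definition block_count (k : nat) : nat :=
  [arg min_(n < (inord (2 ^ k) : 'I_d.+1) | (2 ^ k <= n < 2 ^ k.+1)%N)
     block_diameter n (body I) (start I)]%O.

(** The best step size if the block gradient bound were the Euclidean one divided
    by $2^j$, up to a constant. *)
Definition step_size (e : expert) : R :=
  block_diameter (block_count e.1) (body I) (start I) * 2 ^+ e.2 /
  (l2_grad_bound I * Num.sqrt (horizon I)%:R).

Definition expert_mirror (s : {perm 'I_d}) (e : expert) : 'rV[R]_d -> R :=
  mirror (body I) (start I) (block_count e.1)
    (random_partition (block_count e.1) s).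

Definition expert_play s e (h : seq ('rV[R]_d -> R)) : 'rV[R]_d :=
  ftrl_point (body I) (start I) (expert_mirror s e) (step_size e) h.

Definition expert_loss s h (e : expert) (t : nat) : R :=
  nth (fun=> 0) h t (expert_play s e (take t h)).

(** Makes the two terms of [hedge_regret] equal. *)
Definition hedge_rate : R :=
  Num.sqrt (ln #|expert|%:R / (horizon I)%:R) / value_range I.

Definition expert_weight s h (e : expert) : R :=
  hedge_weight hedge_rate (expert_loss s h) (size h) e.

Definition expert_average s h : 'rV[R]_d :=
  \sum_e expert_weight s h e *: expert_play s e h.

(** The membership test makes this a learner for arbitrary inputs; it always
    succeeds under the hypotheses of the theorem. *)
Definition portfolio_play s h : 'rV[R]_d :=
  if h is [::] then start I
  else if `[< body I (expert_average s h) >] then expert_average s h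
  else start I.

Lemma portfolio_play_body : body I (start I) ->
  forall s h, body I (portfolio_play s h).
Proof.
move=> Kx1 s [|f h] //=; rewrite /portfolio_play.
by case: ifPn => // /asboolP.
Qed.

Lemma uniform_perm_sum1 : \sum_(s : {perm 'I_d}) #|{perm 'I_d}|%:R^-1 = 1 :> R.
Proof.
rewrite sumr_const -[_ *+ _]mulr_natl mulfV// gt_eqF// ltr0n.
by apply/card_gt0P; exists 1%g.
Qed.

(** One permutation drives the partitions of all experts: the pathwise bound
    involves one expert at a time, so only the law of each partition matters. *)
Definition portfolio_learner : learner I :=
  @Learner R d I {perm 'I_d} (fun=> #|{perm 'I_d}|%:R^-1)
    (fun=> ltac:(by rewrite invr_ge0)) uniform_perm_sum1
    portfolio_play (fun=> erefl) portfolio_play_body.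

Lemma block_countP k : (2 ^ k <= d)%N ->
  [/\ (2 ^ k <= block_count k < 2 ^ k.+1)%N, (block_count k <= d)%N &
  forall m, (2 ^ k <= m < 2 ^ k.+1)%N -> (m <= d)%N ->
    block_diameter (block_count k) (body I) (start I) <=
    block_diameter m (body I) (start I)].
Proof.
move=> kd; rewrite /block_count.
case: arg_minP => [|n nk nmin]; first by rewrite inordK// leqnn ltn_exp2l/=.
split; [exact: nk|by rewrite -ltnS|move=> m mk md].
have im : (inord m : 'I_d.+1) = m :> nat by rewrite inordK.
by have := nmin (inord m); rewrite im; apply; exact: mk.
Qed.

End Algorithm.

(** * Regret of the portfolio *)

Section PathwiseRegret.
Context {R : realType} {d : nat}.
Variables (K : set 'rV[R]_d) (x1 : 'rV[R]_d) (T : nat).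
Variable (f : T.-tuple ('rV[R]_d -> R)).
Hypothesis Kclosed : closed K.
Hypothesis Kbounded : bounded_set K.
Hypothesis Kconvex : convex_set K.
Hypothesis Kn0 : K <> [set 0].
Hypothesis Kx1 : K x1.
Hypothesis fK : forall t : 'I_T, admissible_loss K (tnth f t).
Hypothesis d0 : (0 < d)%N.

Local Notation I := (input_of K x1 f).
Local Notation G := (l2_grad_bound I).
Local Notation rho := (value_range I).
Local Notation f0 := (fun=> 0 : R).

Let fb t : has_ubound [set l2norm (grad (tnth f t) x) | x in K].
Proof. by have [] := fK t. Qed.

Let hK g : g \in (f : seq ('rV[R]_d -> R)) -> admissible_loss K g.
Proof. by move=> /tnthP[t ->]. Qed.

Let nth_f (t : 'I_T) : nth f0 f t = tnth f t.
Proof. by rewrite (tnth_nth f0). Qed.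

Lemma range_has_ubound t :
  has_ubound [set tnth f t x - tnth f t z | x in K & z in K].
Proof.
have nd : (0 < 1 <= d)%N by [].
exists (12 * (block_diameter 1 K x1 * block_grad_bound 1 K f)) => _ [x Kx [z Kz <-]].
exact: loss_range_le.
Qed.

Lemma loss_diff_le_range t x z : K x -> K z -> tnth f t x - tnth f t z <= rho.
Proof.
move=> Kx Kz; apply: (@le_trans _ _ (sup [set tnth f t x - tnth f t z | x in K & z in K])).
  by apply: ub_le_sup; [exact: range_has_ubound|exists x => //; exists z].
exact: (le_bigmax _ (fun t => sup [set tnth f t x - tnth f t z | x in K & z in K])).
Qed.

Lemma range_le_diameter n : (0 < n <= d)%N ->
  rho <= 12 * (block_diameter n K x1 * block_grad_bound n K f).
Proof.
move=> nd; apply: bigmax_le => [|t _].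
  by rewrite mulr_ge0// mulr_ge0 ?block_diameter_ge0 ?block_grad_bound_ge0.
apply: ge_sup => [|_ [x Kx [z Kz <-]]]; first by exists (tnth f t x1 - tnth f t x1), x1 => //; exists x1.
exact: loss_range_le.
Qed.

Lemma block_count_bounds (k : 'I_(@grid_size d)) : (0 < block_count I k <= d)%N.
Proof.
have kd : (2 ^ k <= d)%N.
  have /andP[+ _] := @trunc_log_bounds 2 d isT d0.
  apply: leq_trans; rewrite leq_exp2l//; exact: ltn_ord k.
have [/andP[h _] -> _] := @block_countP R d I k kd.
by rewrite andbT; apply: leq_trans h; rewrite expn_gt0.
Qed.

Lemma expert_minimizes s e h : (forall g, g \in h -> admissible_loss K g) ->
  minimizes K (ftrl_objective (expert_mirror I s e) (step_size I e) h)
    (expert_play I s e h).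
Proof.
move=> hh; have nd := block_count_bounds e.1.
have Pn := random_partition_equal s nd.
apply: ftrl_pointP => //; [exact: body_compact|exact: mirror_continuous
  |exact: mirror_start|by move=> x _; exact: mirror_ge0].
Qed.

Lemma expert_play_in s e h : (forall g, g \in h -> admissible_loss K g) ->
  K (expert_play I s e h).
Proof. by move=> /(expert_minimizes s e)[]. Qed.

Lemma expert0 : expert (d := d). Proof. exact: (ord0, ord0). Qed.

Lemma expert_regret s e u : K u -> 0 < step_size I e ->
  \sum_(t < T) expert_loss I s f e t <= \sum_(t < T) tnth f t u +
    sup_mirror K x1 (block_count I e.1) (random_partition (block_count I e.1) s) /
      step_size I e +
    8 * step_size I e * \sum_(t < T)
      sup_dual_grad_sq (random_partition (block_count I e.1) s) K (tnth f t).
Proof.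
move=> Ku eta0; have nd := block_count_bounds e.1.
set n := block_count I e.1 in nd *.
have Pn := random_partition_equal s nd.
set P := random_partition n s in Pn *.
have Pp := equal_partition_partition Pn.
pose Gs t := sup_dual_grad_sq P K (nth f0 f t).
have hG t x : (t < size f)%N -> K x ->
    block_dual_norm P (grad (nth f0 f t) x) ^+ 2 <= Gs t.
  rewrite size_tuple => tT Kx; rewrite /Gs (nth_f (Ordinal tT)).
  by apply: dual_grad_le_sup.
have := ftrl_regret Pp (body_compact Kclosed Kbounded) Kconvex Kx1 eta0
  (mirror_continuous Kclosed Kbounded Kn0 Kx1 nd Pn) (mirror_start K x1 n P)
  (fun x _ => mirror_ge0 Kclosed Kbounded Kn0 Kx1 nd Pn x)
  (mirror_midpoint Kclosed Kbounded Kn0 Kx1 nd Pn) hK hG Ku.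
rewrite size_tuple => h; apply: le_trans h _.
under eq_bigr => t _ do rewrite nth_f.
under [X in _ + 8 * _ * X <= _]eq_bigr => t _ do rewrite /Gs nth_f.
rewrite lerD2r lerD2l ler_pM2r ?invr_gt0//.
exact: mirror_le_sup.
Qed.

(** The weights at time $t$ depend on the first $t$ losses only. *)
Lemma hedge_weight_take s (t : nat) e : (t <= T)%N ->
  expert_weight I s (take t f) e = hedge_weight (hedge_rate I) (expert_loss I s f) t e.
Proof.
move=> tT; have szt : size (take t f) = t by rewrite size_takel// size_tuple.
have E e' : \sum_(r < t) expert_loss I s (take t f) e' r =
    \sum_(r < t) expert_loss I s f e' r.
  apply: eq_bigr => r _; rewrite /expert_loss nth_take// take_takel//.
  exact: ltnW.
have W e' : hedge_potential (hedge_rate I) (expert_loss I s (take t f)) t e' =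
    hedge_potential (hedge_rate I) (expert_loss I s f) t e'.
  by rewrite /hedge_potential E.
by rewrite /expert_weight szt /hedge_weight W (eq_bigr _ (fun e' _ => W e')).
Qed.

Lemma portfolio_loss_le s (t : 'I_T) :
  tnth f t (portfolio_play I s (take t f)) <=
  \sum_e hedge_weight (hedge_rate I) (expert_loss I s f) t e * expert_loss I s f e t.
Proof.
have tT : (t <= T)%N by exact: ltnW.
have tK g : g \in take t f -> admissible_loss K g by move=> /mem_take; exact: hK.
have [fc _ _] := fK t.
pose w e := hedge_weight (hedge_rate I) (expert_loss I s f) t e.
have w0 e : 0 < w e by exact: hedge_weight_gt0.
have w1 : \sum_e w e = 1 by exact: (hedge_weight_sum1 _ _ _ expert0).
have [KA fA] := jensen Kconvex fc w0 w1 (fun e => expert_play_in s e tK).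
have -> : portfolio_play I s (take t f) = \sum_e w e *: expert_play I s e (take t f).
  have avg : expert_average I s (take t f) = \sum_e w e *: expert_play I s e (take t f).
    by apply: eq_bigr => e _; rewrite hedge_weight_take.
  rewrite /portfolio_play avg; case: (take t f) avg KA => [|g h] _ KA.
    by rewrite /expert_play /= -scaler_suml w1 scale1r.
  by case: ifPn => // /asboolP.
apply: le_trans fA _; rewrite le_eqVlt; apply/orP; left; apply/eqP.
by apply: eq_bigr => e _; rewrite /expert_loss nth_f.
Qed.

Lemma portfolio_regret s e : 0 < rho -> 0 < hedge_rate I -> 0 < step_size I e ->
  regret (L := portfolio_learner I) f s <=
    sup_mirror K x1 (block_count I e.1) (random_partition (block_count I e.1) s) /
      step_size I e +
    8 * step_size I e * \sum_(t < T)
      sup_dual_grad_sq (random_partition (block_count I e.1) s) K (tnth f t) +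
    (ln #|@expert d|%:R / hedge_rate I + T%:R * (hedge_rate I * rho ^+ 2)).
Proof.
move=> rho0 eps0 eta0; set B := _ + _.
suff h u : K u -> \sum_(t < T) tnth f t (iterate (L := portfolio_learner I) f s t) - B
    <= \sum_(t < T) tnth f t u.
  rewrite /regret lerBlDr -lerBlDl; apply: lb_le_inf.
    by exists (\sum_(t < T) tnth f t x1), x1.
  by move=> _ [u Ku <-]; exact: h.
move=> Ku; have er := expert_regret s Ku eta0.
have lr i j t : expert_loss I s f i t - expert_loss I s f j t <= rho.
  rewrite /expert_loss; have [tT|Tt] := ltnP t T; last first.
    by rewrite nth_default ?size_tuple// subrr ltW.
  rewrite (nth_f (Ordinal tT)); apply: loss_diff_le_range;
  by apply: expert_play_in => g /mem_take; exact: hK.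
have hr := hedge_regret eps0 lr T e.
have jl : \sum_(t < T) tnth f t (iterate (L := portfolio_learner I) f s t) <=
  \sum_(t < T) \sum_e hedge_weight (hedge_rate I) (expert_loss I s f) t e *
    expert_loss I s f e t.
  by apply: ler_sum => t _; exact: portfolio_loss_le.
by rewrite /B; lra.
Qed.

Lemma portfolio_regret_le0 s : rho <= 0 ->
  regret (L := portfolio_learner I) f s <= 0.
Proof.
move=> rho0; rewrite /regret subr_le0; apply: lb_le_inf.
  by exists (\sum_(t < T) tnth f t x1), x1.
move=> _ [u Ku <-]; apply: ler_sum => t _; rewrite -subr_le0.
apply: le_trans rho0; apply: loss_diff_le_range => //.
exact: (@portfolio_play_body _ _ I Kx1).
Qed.

Lemma mean_permE n (F : {set {set 'I_d}} -> R) : (0 < n <= d)%N ->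
  \sum_(s : {perm 'I_d}) #|{perm 'I_d}|%:R^-1 * F (random_partition n s) =
  mean_partition n F.
Proof. by move=> nd; rewrite mean_partitionE// mulrC mulr_sumr. Qed.

Lemma portfolio_expected_regret e : 0 < rho -> 0 < hedge_rate I -> 0 < step_size I e ->
  expected_regret (portfolio_learner I) f <=
    block_diameter (block_count I e.1) K x1 ^+ 2 / step_size I e +
    8 * step_size I e * (T%:R * block_grad_bound (block_count I e.1) K f ^+ 2) +
    (ln #|@expert d|%:R / hedge_rate I + T%:R * (hedge_rate I * rho ^+ 2)).
Proof.
move=> rho0 eps0 eta0; have nd := block_count_bounds e.1.
have S0 : 0 <= #|{perm 'I_d}|%:R^-1 :> R by rewrite invr_ge0.
rewrite /expected_regret/=.
apply: le_trans (ler_sum _ (fun s _ => ler_wpM2l S0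
  (portfolio_regret s rho0 eps0 eta0))) _.
set n := block_count I e.1 in nd *; set eta := step_size I e in eta0 *.
have E (H : R) : \sum_(s : {perm 'I_d}) #|{perm 'I_d}|%:R^-1 *
    (sup_mirror K x1 n (random_partition n s) / eta +
     8 * eta * (\sum_(t < T) sup_dual_grad_sq (random_partition n s) K (tnth f t)) + H) =
  mean_partition n (sup_mirror K x1 n) / eta + 8 * eta *
    (\sum_(t < T) mean_partition n (fun P => sup_dual_grad_sq P K (tnth f t))) + H.
  under eq_bigr => s _ do rewrite !mulrDr.
  rewrite !big_split/= -mulr_suml uniform_perm_sum1 mul1r; congr (_ + _ + _).
    rewrite -mean_permE// mulr_suml; apply: eq_bigr => s _; exact: mulrA.
  under [in RHS]eq_bigr => t _ do rewrite -mean_permE//.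
  rewrite exchange_big/= mulr_sumr; apply: eq_bigr => s _.
  by rewrite mulrCA mulr_sumr.
rewrite E sqr_block_diameter// lerD2r lerD2l; apply: ler_wpM2l.
  by rewrite mulr_ge0// ltW.
rewrite mulr_natl -[X in _ *+ X](card_ord T) -sumr_const; apply: ler_sum => t _.
exact: (mean_sup_dual_le Kx1).
Qed.

End PathwiseRegret.

(** * Tuning *)

Section GridSize.
Context {R : realType}.

Lemma ln2_ge_half : 1 / 2 <= ln 2 :> R.
Proof.
have : 1 <= ln (2 ^+ 2) :> R by apply: ln_ge1; rewrite -natrX ler_nat.
rewrite lnXn// mulr2n; lra.
Qed.

Lemma ln_ge3 d : (27 <= d)%N -> 3 <= ln d%:R :> R.
Proof.
move=> d27; have l3 : 1 <= ln 3 :> R by exact: ln_ge1.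
apply: (@le_trans _ _ (ln (3 ^+ 3))); first by rewrite lnXn// -[ln 3 *+ _]mulr_natl; lra.
rewrite ler_ln ?posrE ?exprn_gt0// -?natrX ?ler_nat ?ltr0n//.
exact: leq_trans d27.
Qed.

(** $N$ is the square of $M = O(ln d)$, and $M <= (ln d)^2$ once $ln d >= 3$. *)
Lemma ln_card_expert d : (27 <= d)%N ->
  0 < (ln #|@expert d|%:R : R) <= 4 * ln (ln d%:R).
Proof.
move=> d27; have d0 : (0 < d)%N by exact: leq_trans d27.
have l3 := ln_ge3 d27; have lh := ln2_ge_half.
set M := @grid_size d.
have M2 : (1 < M)%N.
  by rewrite /M /grid_size ltnS trunc_log_gt0//; exact: leq_trans d27.
have -> : #|@expert d|%:R = M%:R ^+ 2 :> R by rewrite card_prod !card_ord natrM expr2.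
have M0 : 0 < M%:R :> R by rewrite ltr0n ltnW.
rewrite lnXn// mulr2n; apply/andP; split.
  by rewrite addr_gt0// ln_gt0// (ltr_nat _ 1).
have /andP[tl _] := @trunc_log_bounds 2 d isT d0.
have tl' : (M.-1)%:R * ln 2 <= ln d%:R :> R.
  rewrite mulr_natl -lnXn// ler_ln ?posrE ?exprn_gt0 ?ltr0n//.
  by rewrite -natrX ler_nat.
have ME : M%:R = 1 + (M.-1)%:R :> R by rewrite -natr1 addrC.
have Mle : M%:R <= ln d%:R ^+ 2 :> R.
  have h1 : (M.-1)%:R * (1 / 2) <= (M.-1)%:R * ln 2 :> R by rewrite ler_wpM2l.
  have h2 : 3 * ln d%:R <= ln d%:R ^+ 2 :> R.
    by rewrite expr2 ler_wpM2r//; lra.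
  rewrite ME; lra.
have ll : ln M%:R <= ln (ln d%:R ^+ 2) :> R.
  by rewrite ler_ln ?posrE// exprn_gt0//; lra.
by move: ll; rewrite lnXn; [rewrite mulr2n; lra|lra].
Qed.

End GridSize.

Section Tuning.
Context {R : realType} {d : nat}.
Variables (K : set 'rV[R]_d) (x1 : 'rV[R]_d) (T : nat).
Variable (f : T.-tuple ('rV[R]_d -> R)).
Hypothesis Kclosed : closed K.
Hypothesis Kbounded : bounded_set K.
Hypothesis Kconvex : convex_set K.
Hypothesis Kn0 : K <> [set 0].
Hypothesis Kx1 : K x1.
Hypothesis fK : forall t : 'I_T, admissible_loss K (tnth f t).
Hypothesis d27 : (27 <= d)%N.
Hypothesis T0 : (0 < T)%N.

Local Notation I := (input_of K x1 f).
Local Notation rho := (value_range I).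
Local Notation D n := (block_diameter n K x1).
Local Notation G n := (block_grad_bound n K f).

Let d0 : (0 < d)%N. Proof. exact: leq_trans d27. Qed.

(** Keeping the least diameter only of each dyadic range costs nothing on the
    diameter and a factor 2 on the gradient bound. *)
Lemma dyadic_expert m : (0 < m <= d)%N -> exists k : 'I_(@grid_size d),
  D (block_count I k) <= D m /\ G (block_count I k) <= 2 * G m.
Proof.
move=> md; have /andP[m0 mled] := md.
have kM : (trunc_log 2 m < @grid_size d)%N by rewrite ltnS leq_trunc_log.
exists (Ordinal kM) => /=.
have mb := @trunc_log_bounds 2 m isT m0; have /andP[mlo mhi] := mb.
have kd : (2 ^ trunc_log 2 m <= d)%N by exact: leq_trans mled.
have [/andP[nlo nhi] nd nmin] := @block_countP R d I _ kd.
split; first exact: nmin.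
apply: (block_grad_bound_refine_le Kx1) => //.
- by move=> t; have [] := fK t.
- by rewrite nd andbT; apply: leq_trans nlo; rewrite expn_gt0.
- by apply: leq_trans mhi _; rewrite expnS mul2n leq_double.
Qed.

Lemma dyadic_step (a b : R) : 0 < b -> b <= a -> a <= d%:R * b ->
  exists j : 'I_(@grid_size d), 2 ^+ j * b <= a /\ a <= 2 * 2 ^+ j * b.
Proof.
move=> b0 ba adb; set q := a / b.
have q1 : 1 <= q by rewrite ler_pdivlMr// mul1r.
have qd : q <= d%:R by rewrite ler_pdivrMr.
have q0 : 0 <= q by lra.
have /andP[nq qn] := truncn_itv q0; set N := Num.truncn q in nq qn.
have N0 : (0 < N)%N by rewrite -ltnS -(ltr_nat R); exact: le_lt_trans qn.
have Nd : (N <= d)%N by rewrite -(ler_nat R) (le_trans nq).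
have jM : (trunc_log 2 N < @grid_size d)%N by rewrite ltnS leq_trunc_log.
have /andP[lo hi] := @trunc_log_bounds 2 N isT N0.
exists (Ordinal jM) => /=; split.
  by rewrite -ler_pdivlMr//; apply: le_trans nq; rewrite -natrX ler_nat.
rewrite -ler_pdivrMr//; apply: le_trans (ltW qn) _.
by rewrite -exprS -natrX ler_nat.
Qed.

(** The expert of [dyadic_expert] and [dyadic_step] contributes
    $10 D_n G_n <= 20 D_m G_m$, and Hedge $2 rho sqrt (ln N) <= 48 D_m G_m
    sqrt (ln ln d)$, with $sqrt (ln ln d) >= 1$. *)
Lemma portfolio_regret_le_one m : (0 < m <= d)%N ->
  expected_regret (portfolio_learner I) f / Num.sqrt T%:R <=
  68 * Num.sqrt (ln (ln d%:R)) * (D m * G m).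
Proof.
move=> md.
have fb t : has_ubound [set l2norm (grad (tnth f t) x) | x in K].
  by have [] := fK t.
have T0' : 0 < T%:R :> R by rewrite ltr0n.
have sT0 : 0 < Num.sqrt T%:R :> R by rewrite sqrtr_gt0.
have Dm0 : 0 <= D m := block_diameter_ge0 K x1 m.
have Gm0 : 0 <= G m := block_grad_bound_ge0 K f m.
have lld : 1 <= ln (ln d%:R) :> R by apply: ln_ge1; exact: ln_ge3.
have sll : 1 <= Num.sqrt (ln (ln d%:R)) :> R by rewrite -[leLHS]sqrtr1 ler_wsqrtr.
(* Losses of range 0 are constant on the body; otherwise all the D n and G n are positive. *)
have [rho0|rho0] := leP rho 0.
  apply: (@le_trans _ _ 0); last by rewrite !mulr_ge0// sqrtr_ge0.
  rewrite pmulr_lle0 ?invr_gt0//; apply: sumr_le0 => s _.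
  by rewrite mulr_ge0_le0 ?law_ge0//; exact: portfolio_regret_le0.
have [k [Dk Gk]] := dyadic_expert md.
have nd := block_count_bounds K x1 f d0 k.
set n := block_count I k in Dk Gk nd.
have rhon := range_le_diameter Kclosed Kbounded Kn0 Kx1 fK nd.
have rhom := range_le_diameter Kclosed Kbounded Kn0 Kx1 fK md.
have Dn0 : 0 <= D n := block_diameter_ge0 K x1 n.
have Gn0 : 0 <= G n := block_grad_bound_ge0 K f n.
have DGn : 0 < D n * G n by rewrite -(@pmulr_rgt0 _ 12)//; exact: lt_le_trans rhon.
have Dn : 0 < D n.
  by rewrite lt_neqAle Dn0 andbT; apply: contraTneq DGn => <-; rewrite mul0r ltxx.
have Gn : 0 < G n.
  by rewrite lt_neqAle Gn0 andbT; apply: contraTneq DGn => <-; rewrite mulr0 ltxx.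
have GL : G n <= l2_grad_bound I by exact: (block_grad_bound_le_l2 Kx1 fb).
have L0 : 0 < l2_grad_bound I by exact: lt_le_trans GL.
have LG : l2_grad_bound I <= d%:R * G n.
  have /andP[n0 nled] := nd.
  have d1 : 1 <= d%:R :> R by rewrite (ler_nat _ 1).
  rewrite -ler_sqr ?nnegrE ?mulr_ge0 ?(ltW L0)//.
  apply: le_trans (l2_bound_le_block Kx1 fb nd) _.
  rewrite exprMn ler_wpM2r ?sqr_ge0//.
  by apply: (@le_trans _ _ d%:R); [rewrite ler_nat|rewrite expr2 ler_peMl].
have [j [jlo jhi]] := dyadic_step Gn GL LG.
have lN := @ln_card_expert R d d27; have /andP[lN0 lN4] := lN.
have eps0 : 0 < hedge_rate I.
  by rewrite /hedge_rate divr_gt0// sqrtr_gt0 divr_gt0.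
have eta0 : 0 < step_size I (k, j).
  by rewrite /step_size/= divr_gt0// mulr_gt0// exprn_gt0.
have main := portfolio_expected_regret Kclosed Kbounded Kconvex Kn0 Kx1 fK d0
  rho0 eps0 eta0.
rewrite /= -/n in main.
move: main; rewrite /step_size/= -/n /hedge_rate sqrtrM ?(ltW lN0)// sqrtrV ?(ltW T0')//.
set E := expected_regret _ _; set W := l2_grad_bound I in GL L0 LG jlo jhi *.
set r := value_range I in rho0 rhon rhom *.
set L := ln _ in lN0 lN4 *.
have TE : T%:R = Num.sqrt T%:R ^+ 2 :> R by rewrite sqr_sqrtr// ltW.
have LE : L = Num.sqrt L ^+ 2 by rewrite sqr_sqrtr// ltW.
have sL0 : 0 < Num.sqrt L by rewrite sqrtr_gt0.
have sL : Num.sqrt L <= 2 * Num.sqrt (ln (ln d%:R)).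
  have -> : 2 = Num.sqrt (2 ^+ 2) :> R by rewrite sqrtr_sqr ger0_norm.
  by rewrite -sqrtrM ?sqr_ge0// ler_wsqrtr// (_ : 2 ^+ 2 = 4)//; ring.
have p0 : 0 < 2 ^+ j :> R by rewrite exprn_gt0.
move: TE LE sT0 sL0 sL sll p0 jlo jhi Dk Gk Dn Gn.
set tau := Num.sqrt T%:R; set lam := Num.sqrt L; set sl := Num.sqrt (ln _).
set p := 2 ^+ j; move: (D n) (G n) (D m) (G m) Dm0 Gm0 rhom.
move=> {Dn0 Gn0 DGn rhon GL LG eps0 eta0} Dv Gv Dw Gw Dw0 Gw0 rw.
move=> TE LE tau0 lam0 lamsl sl1 p0 jlo jhi DD GG Dv0 Gv0.
rewrite TE LE.
have -> : Dv ^+ 2 / (Dv * p / (W * tau)) = tau * (Dv * (W / p)).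
  by field; rewrite !gt_eqF.
have -> : 8 * (Dv * p / (W * tau)) * (tau ^+ 2 * Gv ^+ 2) =
    tau * (8 * (Dv * Gv) * (p * Gv / W)).
  by field; rewrite !gt_eqF.
have -> : lam ^+ 2 / (lam / tau / r) + tau ^+ 2 * (lam / tau / r * r ^+ 2) =
    tau * (2 * (lam * r)) by field; rewrite !gt_eqF.
rewrite -!mulrDr => main; rewrite ler_pdivrMr// mulrC.
apply: le_trans main _; rewrite ler_pM2l//.
have DvGv : Dv * Gv <= Dw * (2 * Gw).
  by apply: ler_pM => //; exact: ltW.
have b1 : Dv * (W / p) <= 2 * (Dv * Gv).
  rewrite [leRHS]mulrCA ler_pM2l// ler_pdivrMr//; lra.
have b2 : 8 * (Dv * Gv) * (p * Gv / W) <= 8 * (Dv * Gv).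
  have q1 : p * Gv / W <= 1 by rewrite ler_pdivrMr// mul1r.
  by apply: ler_piMr => //; rewrite mulr_ge0// mulr_ge0// ltW.
have b3 : lam * r <= 2 * sl * (12 * (Dw * Gw)) by apply: ler_pM => //; exact: ltW.
have DG0 : 0 <= Dw * Gw by rewrite mulr_ge0.
have b4 : 20 * (Dw * Gw) <= 20 * (sl * (Dw * Gw)) by rewrite ler_pM2l// ler_peMl.
have -> : 68 * sl * (Dw * Gw) = 68 * (sl * (Dw * Gw)) by ring.
have e1 : 2 * sl * (12 * (Dw * Gw)) = 24 * (sl * (Dw * Gw)) by ring.
rewrite e1 in b3; have e2 : Dw * (2 * Gw) = 2 * (Dw * Gw) by ring.
rewrite e2 in DvGv; lra.
Qed.

End Tuning.

Theorem corollary2 (R : realType) :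
  exists (A : oco_algorithm R) (C : R) (d0 : nat), 0 < C /\
    forall (d : nat) (K : set 'rV[R]_d) (x1 : 'rV[R]_d) (T : nat)
      (f : T.-tuple ('rV[R]_d -> R)),
    (d0 <= d)%N ->
    closed K -> bounded_set K -> convex_set K -> K <> [set 0] ->
    (forall x, K x -> l1norm x <= 1) ->
    K x1 ->
    (forall t : 'I_T, admissible_loss K (tnth f t)) ->
    4 * ln (ln d%:R) <= T%:R :> R ->
    expected_regret (A d (input_of K x1 f)) f / Num.sqrt T%:R
      <= C * Num.sqrt (ln (ln d%:R)) *
         \big[Num.min/block_diameter 1 K x1 * block_grad_bound 1 K f]_(1 <= n < d.+1)
            (block_diameter n K x1 * block_grad_bound n K f).
Proof.
(* For d >= 27 one has ln d >= 3, and hence ln (ln d) >= 1. *)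
exists (fun d I => portfolio_learner I), 68, 27%N; split => //.
move=> d K x1 T f d27 Kclosed Kbounded Kconvex Kn0 _ Kx1 fK TlnR.
have lld : 1 <= ln (ln d%:R) :> R by apply: ln_ge1; exact: ln_ge3.
have T0 : (0 < T)%N by rewrite -(ltr_nat R); apply: lt_le_trans TlnR; lra.
have bound m : (0 < m <= d)%N ->
    expected_regret (portfolio_learner (input_of K x1 f)) f / Num.sqrt T%:R <=
    68 * Num.sqrt (ln (ln d%:R)) * (block_diameter m K x1 * block_grad_bound m K f).
  exact: portfolio_regret_le_one.
have c0 : 0 < 68 * Num.sqrt (ln (ln d%:R)) :> R.
  by rewrite mulr_gt0// sqrtr_gt0; lra.
rewrite -ler_pdivrMl// big_nat; apply: le_bigmin => [|m].
  by rewrite ler_pdivrMl// bound// (leq_trans _ d27).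
by rewrite ltnS => md; rewrite ler_pdivrMl// bound.
Qed.
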